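(* Let $\Phi$ be an irreducible, reduced and simply laced root system in a finite-dimensional real inner product space $(V,\langle\,,\,\rangle)$, i.e. of type $A_n$ ($n\ge1$), $D_n$ ($n\ge4$), $E_6$, $E_7$ or $E_8$, with Coxeter number $h$. Let $P$ be a symmetric alcoved polytope of this type. Then $P$ has a generating set consisting of $h$ vertices of $P$.
   Context: An alcoved polytope of type $t$ is a bounded set of the form $\bigcap_{a \in \Psi}\{x \in V : \langle a, x\rangle \le c_a\}$, where $\Psi$ is a subset of a root system $\Phi$ of type $t$ in $V$ and $c_a \in \mathbb{R}$. The Weyl group $W$ is the group generated by the reflections in the hyperplanes orthogonal to the roots. An alcoved polytope is symmetric if it is invariant under $W$. A subset $\Sigma \subseteq V$ is a generating set of $P$ if $P$ is the smallest alcoved polytope (for $\Phi$) in $V$ containing $\Sigma$. The Coxeter number $h$ is the order in $W$ of a Coxeter element $s_{b_1}\circ\cdots\circ s_{b_n}$ for a basis of simple roots $b_1,\dots,b_n$.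
   Formalization: P is assumed nonempty (the empty set has no vertices), and for P = {0}, which has only one vertex while h ≥ 2, the h vertices are counted with repetition; in all other cases they are distinct. *)

(* Defs.v *)
From HB Require Import structures.
From mathcomp Require Import all_boot all_order all_algebra.
From mathcomp Require Import sesquilinear.
From mathcomp Require Import boolp classical_sets reals.

Set Implicit Arguments.
Unset Strict Implicit.
Unset Printing Implicit Defensive.

Import Order.TTheory GRing.Theory Num.Theory.
Local Open Scope classical_set_scope.
Local Open Scope ring_scope.

(* A real inner product space is a vectType over a realType with a positive
   definite symmetric bilinear form. The finite set of roots is represented by
   a sequence, only membership in which is ever used. *)
Section AlcovedPolytopes.
Variables (R : realType) (V : vectType R) (dot : {dot V for @idfun R}).
Implicit Types (Phi b : seq V) (P Q Sigma : set V) (w : V -> V).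

Definition reflection (a x : V) : V := x - (2 * dot a x / dot a a) *: a.

Record root_system Phi : Prop := RootSystem {
  root_span : <<Phi>>%VS = fullv;
  root_neq0 : 0 \notin Phi;
  root_reflection : forall a x, a \in Phi -> x \in Phi ->
    reflection a x \in Phi;
  root_integral : forall a x, a \in Phi -> x \in Phi ->
    2 * dot a x / dot a a \is a Num.int
}.

Definition reduced Phi : Prop :=
  forall (a : V) (t : R), a \in Phi -> t *: a \in Phi -> t = 1 \/ t = -1.

Definition irreducible Phi : Prop :=
  Phi <> [::] /\
  ~ exists Phi1 Phi2 : seq V,
      [/\ Phi1 <> [::], Phi2 <> [::], Phi =i Phi1 ++ Phi2
        & forall x y, x \in Phi1 -> y \in Phi2 -> dot x y = 0].

Definition simply_laced Phi : Prop :=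
  forall x y, x \in Phi -> y \in Phi -> dot x x = dot y y.

Definition reflection_prod (s : seq V) : V -> V :=
  foldr (fun a f => reflection a \o f) id s.

(* Reflections are involutions, so the group they generate consists of the
   finite products of reflections. *)
Definition weyl_group Phi : set (V -> V) :=
  [set w | exists2 s : seq V, {subset s <= Phi} & w = reflection_prod s].

Definition simple_roots Phi b : Prop :=
  [/\ basis_of fullv b, {subset b <= Phi}
    & forall a, a \in Phi -> exists c : nat -> nat,
        a = \sum_(i < size b) b`_i *+ c i \/
        a = - \sum_(i < size b) b`_i *+ c i].

Definition has_order w (m : nat) : Prop :=
  [/\ (0 < m)%N, iter m w =1 id
    & forall k, (0 < k < m)%N -> ~ iter k w =1 id].

Definition coxeter_number Phi (h : nat) : Prop :=
  exists2 b : seq V, simple_roots Phi b & has_order (reflection_prod b) h.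

Definition alcoved_polytope Phi P : Prop :=
  (exists M : R, forall x, P x -> dot x x <= M) /\
  exists (Psi : seq V) (c : V -> R), {subset Psi <= Phi} /\
    P = [set x | forall a, a \in Psi -> dot a x <= c a].

Definition weyl_symmetric Phi P : Prop :=
  forall w, weyl_group Phi w -> w @` P = P.

Definition generating_set Phi P Sigma : Prop :=
  [/\ alcoved_polytope Phi P, Sigma `<=` P
    & forall Q, alcoved_polytope Phi Q -> Sigma `<=` Q -> P `<=` Q].

(* A vertex is a zero-dimensional face: the unique maximizer over P of some
   linear functional, here written as an inner product. *)
Definition vertex P (v : V) : Prop :=
  P v /\ exists u : V, forall x, P x -> x <> v -> dot u x < dot u v.

End AlcovedPolytopes.

(* Main.v *)
Require Import Defs.
From HB Require Import structures.
From mathcomp Require Import all_boot all_order all_algebra.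
From mathcomp Require Import sesquilinear.
From mathcomp Require Import boolp classical_sets reals.
From mathcomp Require Import zify ring lra.

Set Implicit Arguments.
Unset Strict Implicit.
Unset Printing Implicit Defensive.

Import Order.TTheory GRing.Theory Num.Theory.
Local Open Scope classical_set_scope.
Local Open Scope ring_scope.

(** Since W is transitive on the roots, P is {x : <a, x> <= m for every root a},
    so h vertices generate P as soon as every root attains the value m on one of
    them. We use the orbit of a suitable vertex v under a Coxeter element
    c = s_1 ... s_n: it covers all roots if every c-orbit of roots meets the
    facet F_v = {a : <a, v> = m} of the root polytope. Each c-orbit contains some
    theta_i = s_1 ... s_(i-1) b_i, because its sum vanishes and so it changes sign
    somewhere. The orbit of v then has h distinct elements: its span lies in no
    reflecting hyperplane, so a power of c fixing v fixes a regular vector and is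
    trivial.

    If some fundamental coweight omega_r is minuscule, order the simple roots
    outwards from r (all orders give conjugate Coxeter elements, the diagram
    being a tree); every theta_i then lies on the facet of v = omega_r. Otherwise
    all coefficients of the highest root are at least 2; they are additive on the
    affine diagram, which forces the type E8, where an explicit vertex works. *)

(** Rescaling the inner product gives every root norm 2 and turns m into 1. Pairings of roots are
    then integers between -2 and 2, and arguments about roots become case distinctions on five
    values. Two conditions on v are carried along with the covering of the roots: no root exceeds 1
    on v, which puts v in P, and the roots with value 1 on v span V, which makes v a vertex, exposed
    by the sum of these roots. The number h is the order of a Coxeter element for an arbitrary order
    of the simple roots, while the facet argument dictates an order; hence the need for conjugacy.
    An order outwards from r works because the inverse of s_1 ... s_(i-1) takes omega_r to omega_r -
    b_1 - ... - b_(i-1), and b_i pairs to -1 with the subtracted sum. In the other case the marks of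
    the highest root, read from the affine node, run 1, 2, 3, ... up to the first branching; as all
    later marks are at least 2, counting leaves only a branching node of mark 6. *)

Lemma iter_modn (T : Type) p (f : T -> T) x k :
  iter p f x = x -> iter k f x = iter (k %% p) f x.
Proof.
move=> fx; rewrite {1}(divn_eq k p) addnC iterD; congr (iter _ _ _).
by elim: (k %/ p)%N => // n IH; rewrite mulSn addnC iterD fx.
Qed.

(** * Reflections *)

Section Form.
Variables (R : realType) (V : vectType R) (B : V -> V -> R).
Implicit Types (a x y z u v : V) (s t g e vs : seq V).
Hypothesis BC : forall x y, B x y = B y x.
Hypothesis BDr : forall x y z, B x (y + z) = B x y + B x z.
Hypothesis BZr : forall k x y, B x (k *: y) = k * B x y.
Hypothesis B_gt0 : forall x, x != 0 -> 0 < B x x.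

Lemma BDl x y z : B (x + y) z = B x z + B y z.
Proof. by rewrite BC BDr !(BC z). Qed.
Lemma BZl k x y : B (k *: x) y = k * B x y.
Proof. by rewrite BC BZr (BC y). Qed.
Lemma BNr x y : B x (- y) = - B x y.
Proof. by rewrite -scaleN1r BZr mulN1r. Qed.
Lemma BNl x y : B (- x) y = - B x y.
Proof. by rewrite BC BNr (BC y). Qed.
Lemma B0r x : B x 0 = 0.
Proof. by rewrite -(scale0r 0) BZr mul0r. Qed.
Lemma B0l x : B 0 x = 0.
Proof. by rewrite BC B0r. Qed.
Lemma B_sumr (I : Type) (s : seq I) (P : pred I) (F : I -> V) x :
  B x (\sum_(i <- s | P i) F i) = \sum_(i <- s | P i) B x (F i).
Proof. exact: (big_morph (B x) (BDr x) (B0r x)). Qed.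
Lemma B_suml (I : Type) (s : seq I) (P : pred I) (F : I -> V) x :
  B (\sum_(i <- s | P i) F i) x = \sum_(i <- s | P i) B (F i) x.
Proof. by rewrite BC B_sumr; apply: eq_bigr => i _; rewrite BC. Qed.
Lemma B_eq0 x : B x x = 0 -> x = 0.
Proof. by move=> xx0; apply/eqP; apply: contra_eqT xx0 => /B_gt0/gt_eqF->. Qed.
Lemma B_ge0 x : 0 <= B x x.
Proof. by have [->|/B_gt0/ltW//] := eqVneq x 0; rewrite B0r. Qed.

(** This is the orthogonal reflection when [B a a = 2]; the formula without division is linear and
    self-adjoint for every [a]. *)
Definition refl (a x : V) : V := x - B a x *: a.

Lemma reflD a x y : refl a (x + y) = refl a x + refl a y.
Proof. by rewrite /refl BDr scalerDl opprD addrACA. Qed.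
Lemma reflZ a k x : refl a (k *: x) = k *: refl a x.
Proof. by rewrite /refl BZr scalerBr scalerA. Qed.
Lemma B_refl a x y : B (refl a x) y = B x (refl a y).
Proof. by rewrite /refl BDl BDr BNl BNr BZl BZr (BC x a) mulrC. Qed.
Lemma refl_id a x : B a x = 0 -> refl a x = x.
Proof. by rewrite /refl => ->; rewrite scale0r subr0. Qed.
Lemma refl_comm a b x : B a b = 0 -> refl a (refl b x) = refl b (refl a x).
Proof.
move=> ab; rewrite /refl !BDr !BNr !BZr ab (BC b a) ab !mulr0 !subr0.
by rewrite addrAC.
Qed.

Section Norm2.
Variable a : V.
Hypothesis a2 : B a a = 2.
Lemma reflK : involutive (refl a).
Proof.
move=> x; rewrite /refl BDr BNr BZr a2 -addrA -opprD -scalerDl.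
suff -> : B a x + (B a x - B a x * 2) = 0 by rewrite scale0r subr0.
ring.
Qed.
Lemma refl_self : refl a a = - a.
Proof. by rewrite /refl a2 scaler_nat mulr2n opprD addNKr. Qed.
End Norm2.

Local Notation "s @@ x" := (foldr refl x s) (at level 35, right associativity).

Lemma reflsD s x y : s @@ (x + y) = s @@ x + s @@ y.
Proof. by elim: s => //= a s ->; rewrite reflD. Qed.
Lemma reflsZ s k x : s @@ (k *: x) = k *: (s @@ x).
Proof. by elim: s => //= a s ->; rewrite reflZ. Qed.
Lemma reflsN s x : s @@ (- x) = - (s @@ x).
Proof. by rewrite -scaleN1r reflsZ scaleN1r. Qed.
Lemma refls0 s : s @@ 0 = 0.
Proof. by have := reflsZ s 0 0; rewrite !scale0r. Qed.
Lemma refls_sum s (I : Type) (r : seq I) (F : I -> V) :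
  s @@ (\sum_(i <- r) F i) = \sum_(i <- r) s @@ F i.
Proof. by elim/big_rec2: _ => [|i y z _ <-]; rewrite ?refls0 ?reflsD. Qed.
Lemma refls_cat s t x : (s ++ t) @@ x = s @@ t @@ x.
Proof. exact: foldr_cat. Qed.
Lemma B_refls s x y : B (s @@ x) y = B x (rev s @@ y).
Proof.
elim: s y => // a s IH y.
by rewrite /= B_refl IH rev_cons -cats1 refls_cat.
Qed.

Section Roots.
Variable Phi : seq V.
Hypothesis Phi2 : {in Phi, forall a, B a a = 2}.
Hypothesis Phi_refl : {in Phi &, forall a x, refl a x \in Phi}.
Hypothesis Phi_int : {in Phi &, forall a x, B a x \is a Num.int}.

Lemma refls_revK s x : {subset s <= Phi} -> rev s @@ s @@ x = x.
Proof.
elim: s x => // a s IH x sP /=.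
rewrite rev_cons -cats1 refls_cat /= reflK ?Phi2 ?sP ?mem_head //.
by apply: IH => y ys; apply: sP; rewrite inE ys orbT.
Qed.
Lemma refls_Krev s x : {subset s <= Phi} -> s @@ rev s @@ x = x.
Proof.
by move=> sP; have := @refls_revK (rev s) x; rewrite revK; apply=> y; rewrite mem_rev; apply: sP.
Qed.
Lemma B_refls2 s x y : {subset s <= Phi} -> B (s @@ x) (s @@ y) = B x y.
Proof. by move=> sP; rewrite B_refls refls_revK. Qed.
Lemma refls_root s a : {subset s <= Phi} -> a \in Phi -> s @@ a \in Phi.
Proof.
move=> + aP; elim: s => //= b s IH sP.
by apply: Phi_refl; [apply/sP/mem_head | apply: IH => y ys; apply: sP; rewrite inE ys orbT].
Qed.
Lemma root_opp a : a \in Phi -> - a \in Phi.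
Proof. by move=> aP; rewrite -refl_self ?Phi2 // Phi_refl. Qed.
Lemma root_nz a : a \in Phi -> a != 0.
Proof.
by move=> aP; apply/eqP => a0; have := Phi2 aP; rewrite a0 B0r => /esym/eqP; rewrite pnatr_eq0.
Qed.

Lemma root_B_eq2 a x : a \in Phi -> x \in Phi -> B a x = 2 -> a = x.
Proof.
move=> aP xP ax; apply/eqP; rewrite -subr_eq0; apply/eqP/B_eq0.
by rewrite BDl !BDr !BNl !BNr (BC x a) ax !Phi2 //; ring.
Qed.

(** Positivity of the form on [a + x] and [a - x] bounds the integer [B a x] by 2 in absolute value,
    and the two extreme values force [a = x] or [a = - x]. *)
Lemma root_B_cases a x : a \in Phi -> x \in Phi ->
  [\/ a = x, a = - x | [\/ B a x = 1, B a x = 0 | B a x = -1]].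
Proof.
move=> aP xP.
have := B_ge0 (a + x); have := B_ge0 (a - x).
rewrite !BDl !BDr !BNl !BNr (BC x a) !Phi2 // => l1 l2.
have {}l1 : B a x <= 2 by lra.
have {l2} : -2 <= B a x by lra.
have /intrP[k ek] := Phi_int aP xP; rewrite ek in l1 *.
move: l1; rewrite -[2]/(2%:~R) -(rmorphN (intmul 1)) !ler_int => l1 l2.
have [k2|] := eqVneq k 2.
  by apply: Or31; apply: root_B_eq2; rewrite // ek k2.
have [k2 _|] := eqVneq k (-2).
  by apply: Or32; apply: root_B_eq2; rewrite ?root_opp // BNr ek k2 -rmorphN.
have [->|k1] := eqVneq k 1; first by move=> *; apply/Or33/Or31.
have [->|k0] := eqVneq k 0; first by move=> *; apply/Or33/Or32.
have [->|km1] := eqVneq k (-1); first by move=> *; apply/Or33/Or33; rewrite rmorphN.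
by move=> *; lia.
Qed.

Hypothesis Phi_irr : forall p : pred V,
  has p Phi -> has (predC p) Phi -> exists x y,
    [/\ x \in Phi, y \in Phi, p x, ~~ p y & B x y <> 0].

(** If the orbit of [a] missed a root, irreducibility would give x in the orbit and y outside it
    with nonzero pairing. In each case a word in the two reflections carries x to y: for pairing 1,
    through x - y and -y; for pairing -1, through x + y. *)
Lemma root_transitive a a' : a \in Phi -> a' \in Phi ->
  exists2 s, {subset s <= Phi} & s @@ a = a'.
Proof.
move=> aP a'P; pose p x := `[< exists2 s, {subset s <= Phi} & s @@ a = x >].
have [/asboolP//|np] := boolP (p a').
have [||x [y [xP yP /asboolP[s sP sx] /asboolP npy xy]]] := Phi_irr (p := p).
- by apply/hasP; exists a => //; apply/asboolP; exists [::].
- by apply/hasP; exists a'.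
have ext t : {subset t <= [:: x; y]} -> t @@ x = y -> p y.
  move=> txy ty; apply/asboolP; exists (t ++ s); last by rewrite refls_cat sx.
  by move=> z; rewrite mem_cat => /orP[/txy|/sP//]; rewrite !inE => /orP[] /eqP->.
exfalso; apply: npy; apply/asboolP.
have yNy : refl y (- y) = y.
  by rewrite -scaleN1r reflZ refl_self ?Phi2 // scalerN scaleN1r opprK.
have [xe|xe|[xe|//|xe]] := root_B_cases xP yP.
- exact: (ext [::]).
- apply: (ext [:: y]) => [z|]; first by rewrite !inE orbC => ->.
  by rewrite /= xe yNy.
- apply: (ext [:: y; x; y]) => [z|].
    by rewrite !inE => /or3P[] ->; rewrite ?orbT.
  have e1 : refl y x = x - y by rewrite /refl BC xe scale1r.
  have e2 : refl x y = y - x by rewrite /refl xe scale1r.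
  rewrite /= e1 reflD -scaleN1r reflZ e2 refl_self ?Phi2 // scaleN1r opprB.
  by rewrite addrA addNr add0r yNy.
- apply: (ext [:: x; y]) => [//|].
  have e1 : refl y x = x + y by rewrite /refl BC xe scaleN1r opprK.
  have e2 : refl x y = y + x by rewrite /refl xe scaleN1r opprK.
  by rewrite /= e1 reflD e2 refl_self ?Phi2 // addrCA addNr addr0.
Qed.

(** * Simple roots *)

(* [om] is the dual basis of [b], so [B a (om y)] is the coefficient of [y] in [a]. *)
Section Simple.
Variables (b : seq V) (om : V -> V).
Hypothesis b_uniq : uniq b.
Hypothesis b_root : {subset b <= Phi}.
Hypothesis om_dual : {in b &, forall x y, B x (om y) = (x == y)%:R}.
Hypothesis b_expand : forall x, x = \sum_(y <- b) B x (om y) *: y.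
Hypothesis b_sign : forall a, a \in Phi ->
  exists2 s : seq V, {subset s <= b} & a = \sum_(y <- s) y \/ a = - \sum_(y <- s) y.

Definition pos a := {in b, forall y, 0 <= B a (om y)}.

Lemma om_id y : y \in b -> B y (om y) = 1.
Proof. by move=> yb; rewrite om_dual ?eqxx. Qed.

Lemma coef_sum s y : {subset s <= b} -> y \in b ->
  B (\sum_(z <- s) z) (om y) = (count_mem y s)%:R.
Proof.
move=> + yb; elim: s => [|z s IH] sb; first by rewrite big_nil B0l.
have zb : z \in b by apply/sb/mem_head.
rewrite big_cons BDl om_dual // IH ?natrD // => u us.
by apply: sb; rewrite inE us orbT.
Qed.

Lemma pos_sum s : {subset s <= b} -> pos (\sum_(z <- s) z).
Proof. by move=> sb y yb; rewrite coef_sum. Qed.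

Lemma root_pos a : a \in Phi -> pos a \/ pos (- a).
Proof.
by case/b_sign=> s sb [] ->; [left|right; rewrite opprK]; apply: pos_sum.
Qed.

Lemma B_simple_eq0 x : {in b, forall y, B y x = 0} -> x = 0.
Proof.
move=> x0; apply: B_eq0; rewrite {1}(b_expand x) B_suml big_seq big1 // => y yb.
by rewrite BZl x0 ?mulr0.
Qed.

Lemma coef_eq x y : {in b, forall z, B x (om z) = B y (om z)} -> x = y.
Proof.
move=> xy; rewrite (b_expand x) (b_expand y) !big_seq.
by apply: eq_bigr => z zb; rewrite xy.
Qed.

Lemma pos_antisym a : pos a -> pos (- a) -> a = 0.
Proof.
move=> p n; apply: coef_eq => y yb; apply/eqP; rewrite B0l eq_le p // andbT.
by rewrite -oppr_ge0 -BNl n.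
Qed.

Lemma root_seq a : a \in Phi -> pos a ->
  exists2 s : seq V, {subset s <= b} & a = \sum_(y <- s) y.
Proof.
move=> aP pa; case: (b_sign aP) => s sb [->|e]; first by exists s.
exists [::] => //; rewrite big_nil; apply: pos_antisym => //.
by rewrite e opprK; apply: pos_sum.
Qed.

Lemma coef_nat a y : a \in Phi -> pos a -> y \in b ->
  exists n : nat, B a (om y) = n%:R.
Proof.
move=> aP pa yb; have [s sb ->] := root_seq aP pa.
by exists (count_mem y s); rewrite coef_sum.
Qed.

Lemma pos_b y : y \in b -> pos y.
Proof. by move=> yb z zb; rewrite om_dual. Qed.

(** Pairing 1 would make [x - y] a root with coefficients of both signs. *)
Lemma simple_B x y : x \in b -> y \in b -> x != y -> B x y = 0 \/ B x y = -1.
Proof.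
move=> xb yb xy.
have xPhi := b_root xb; have yPhi := b_root yb.
have [xeq|xe|[xe|//|//]] := root_B_cases xPhi yPhi; [|exfalso..|by left|by right].
- by rewrite xeq eqxx in xy.
- have : B x (om y) = 0 by rewrite om_dual // (negPf xy).
  by rewrite xe BNl om_id // => /eqP; rewrite oppr_eq0 oner_eq0.
- have := Phi_refl xPhi yPhi; rewrite /refl xe scale1r => /root_pos[] /= p.
    have := p x xb; rewrite BDl BNl !om_dual // eqxx eq_sym (negPf xy) sub0r.
    by rewrite oppr_ge0 ler10.
  have := p y yb; rewrite opprB BDl BNl !om_dual // eqxx (negPf xy) sub0r.
  by rewrite oppr_ge0 ler10.
Qed.

Lemma simple_B_le0 x y : x \in b -> y \in b -> x != y -> B x y <= 0.
Proof. by move=> xb yb xy; case: (simple_B xb yb xy) => ->; lra. Qed.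

(** Only the coefficient of [y] changes. If the image were negative, all other coefficients of [a]
    would vanish, and a positive multiple of [y] of norm 2 is [y]. *)
Lemma refl_pos y a : y \in b -> a \in Phi -> pos a -> a != y -> pos (refl y a).
Proof.
move=> yb aP pa ay; have yPhi := b_root yb.
have [//|n] := root_pos (Phi_refl yPhi aP).
suff ea : a = B a (om y) *: y.
  have := Phi2 aP; have := pa y yb; rewrite {2 3}ea BZl BZr Phi2 // => ge0 /eqP.
  set k := B a (om y) in ea ge0 * => k2.
  have k1 : k = 1 by move/eqP: k2 => k2; nra.
  by rewrite ea k1 scale1r eqxx in ay.
apply: coef_eq => z zb; rewrite BZl (om_dual yb zb).
have [<-|yz] := eqVneq y z; first by rewrite mulr1.
have := n z zb; have := pa z zb.
by rewrite /refl BNl BDl BNl BZl (om_dual yb zb) (negPf yz) mulr0n; lra.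
Qed.

Lemma pos_neq_neg a : a \in Phi -> pos a -> ~ pos (- a).
Proof. by move=> aP p n; have := root_nz aP; rewrite (pos_antisym p n) eqxx. Qed.

Lemma sub_root s : {subset s <= b} -> {subset s <= Phi}.
Proof. by move=> sb y /sb/b_root. Qed.

(** Apply the letters one at a time from the right: by [refl_pos], the sign can turn negative at a
    letter y only if the current root is y itself. *)
Lemma word_neg_split s a : {subset s <= b} -> a \in Phi -> pos a ->
  pos (- (s @@ a)) -> exists s1 y s2, s = s1 ++ y :: s2 /\ s2 @@ a = y.
Proof.
move=> + aP pa; elim: s => [|y s IH] sb /=; first by move/(pos_neq_neg aP pa).
have yb : y \in b by apply/sb/mem_head.
have {}sb : {subset s <= b} by move=> z zs; apply: sb; rewrite inE zs orbT.
have saP : s @@ a \in Phi by apply: refls_root => //; apply: sub_root.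
move=> n; have [p|{}n] := root_pos saP; last first.
  by have [s1 [z [s2 [-> e]]]] := IH sb n; exists (y :: s1), z, s2.
exists [::], y, s; split=> //; apply/eqP/contraT => ne.
by have /(pos_neq_neg (Phi_refl (b_root yb) saP)) := refl_pos yb saP p ne.
Qed.

Lemma refl_refls s a x : {subset s <= Phi} ->
  refl (s @@ a) x = s @@ refl a (rev s @@ x).
Proof.
by move=> sP; rewrite {2}/refl reflsD reflsN reflsZ refls_Krev // -B_refls.
Qed.

(** This is the deletion argument. If y is the last letter, the rest of the word makes y negative,
    hence takes it to some letter z on the way; the reflection in z is then a conjugate of that in
    y, both letters cancel, and the word is shorter by two. *)
Lemma word_pos_id s : {subset s <= b} -> {in b, forall y, pos (s @@ y)} ->
  forall x, s @@ x = x.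
Proof.
have [n] := ubnP (size s); elim: n s => // n IH s.
case: (lastP s) => // t y; rewrite size_rcons => lt_n sb ps.
have yb : y \in b by apply/sb; rewrite mem_rcons mem_head.
have tb : {subset t <= b} by move=> z zt; apply: sb; rewrite mem_rcons inE zt orbT.
have : pos (- (t @@ y)).
  by rewrite -reflsN -refl_self ?Phi2 ?b_root // -foldr_rcons; apply: ps.
case/(word_neg_split tb (b_root yb) (pos_b yb)) => s1 [z [s2 [et ez]]].
have s2b : {subset s2 <= b} by move=> u us; apply: tb; rewrite et mem_cat inE us !orbT.
have s1b : {subset s1 <= b} by move=> u us; apply: tb; rewrite et mem_cat us.
have e x : rcons t y @@ x = (s1 ++ s2) @@ x.
  rewrite foldr_rcons et !refls_cat /= -{1}ez refl_refls; last exact: sub_root.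
  by rewrite refls_revK ?reflK ?Phi2 ?b_root //; apply: sub_root.
move=> x; rewrite e; apply: IH.
- by move: lt_n; rewrite et !size_cat /= addnS ltnS; apply: leq_trans.
- by move=> u; rewrite mem_cat => /orP[/s1b|/s2b].
- by move=> u ub; rewrite -e; apply: ps.
Qed.

Lemma pos_dominant a x : pos a -> {in b, forall y, 0 <= B y x} -> 0 <= B a x.
Proof.
move=> pa dx; rewrite (b_expand a) B_suml big_seq; apply: sumr_ge0 => y yb.
by rewrite BZl mulr_ge0 ?pa ?dx.
Qed.

(** * Regular vectors and their stabilizers *)

Definition regular x := {in Phi, forall a, B a x != 0}.

(** The induction is on the number of positive roots negative on x. Reflecting in a simple y with
    [B y x < 0] permutes the positive roots other than y, so it removes exactly y from that set. *)
Lemma regular_dominant x : regular x ->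
  exists2 g, {subset g <= b} & {in b, forall y, 0 < B y (g @@ x)}.
Proof.
pose neg x := [seq a <- undup Phi | `[< pos a >] && (B a x < 0)].
have [n] := ubnP (size (neg x)); elim: n x => // n IH x lt_n rx.
have [/allP dx|/allPn[y yb]] := boolP (all (fun y => 0 < B y x) b).
  by exists [::].
have yP := b_root yb.
rewrite -leNgt le_eqVlt (negPf (rx y yP)) /= => yx.
have [||g gb dg] := IH (refl y x); last first.
- exists (rcons g y); first by move=> z; rewrite mem_rcons inE => /predU1P[->|/gb].
  by move=> z zb; rewrite foldr_rcons dg.
- by move=> a aP; rewrite -B_refl rx ?Phi_refl.
rewrite ltnS in lt_n; apply: leq_trans lt_n.
have yneg : y \in neg x.
  by rewrite mem_filter yx mem_undup yP !andbT; apply/asboolP/pos_b.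
rewrite -(size_map (refl y) (neg (refl y x))).
have -> : size (neg x) = (size (rem y (neg x))).+1.
  by rewrite size_rem // prednK //; case: (neg x) yneg.
rewrite ltnS; apply: uniq_leq_size.
  by rewrite map_inj_uniq ?filter_uniq ?undup_uniq //; apply/can_inj/reflK/Phi2.
move=> _ /mapP[a + ->]; rewrite mem_filter mem_undup => /andP[/andP[/asboolP pa ax] aP].
rewrite -B_refl in ax.
have ay : a != y.
  by apply: contraTneq ax => ->; rewrite refl_self ?Phi2 // BNl oppr_lt0 -leNgt ltW.
rewrite mem_rem_uniq ?filter_uniq ?undup_uniq // !inE mem_filter ax mem_undup Phi_refl //.
rewrite !andbT; apply/andP; split; last by apply/asboolP/refl_pos.
apply/eqP => e.
have ea : a = - y by rewrite -(reflK (Phi2 yP) a) e refl_self ?Phi2.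
by move: pa; rewrite ea; apply: pos_neq_neg => //; apply: pos_b.
Qed.

(** Conjugation moves x into the open dominant chamber. A word fixing such a vector preserves its
    pairings, so it keeps the simple roots positive and is trivial. *)
Lemma regular_stab s x : {subset s <= b} -> regular x -> s @@ x = x ->
  forall u, s @@ u = u.
Proof.
move=> sb rx sx; have [g gb dg] := regular_dominant rx.
have gP := sub_root gb; have sP := sub_root sb.
pose w := g ++ s ++ rev g.
have wb : {subset w <= b}.
  by move=> z; rewrite !mem_cat mem_rev => /or3P[/gb|/sb|/gb].
have wg : w @@ g @@ x = g @@ x by rewrite !refls_cat refls_revK // sx.
have w1 : forall u, w @@ u = u.
  apply: word_pos_id => // y yb.
  have wyP : w @@ y \in Phi by apply: refls_root; [apply: sub_root|apply: b_root].
  have [//|n] := root_pos wyP.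
  have /(pos_dominant n) : {in b, forall z, 0 <= B z (g @@ x)}.
    by move=> z zb; apply/ltW/dg.
  by rewrite BNl -{1}wg B_refls2 ?oppr_ge0 ?leNgt ?dg //; apply: sub_root.
move=> u; have := w1 (g @@ u); rewrite !refls_cat refls_revK // => e.
by rewrite -[s @@ u](refls_revK _ gP) e refls_revK.
Qed.

Lemma poly_nonroot (p : {poly R}) : p != 0 -> exists r : R, p.[r] != 0.
Proof.
move=> p0; pose rs : seq R := [seq i%:R | i <- iota 0 (size p)].
have [/allP rp|/allPn[t _ nt]] := boolP (all (root p) rs); last by exists t.
have urs : uniq rs.
  by rewrite map_inj_uniq ?iota_uniq // => i j /eqP; rewrite eqr_nat => /eqP.
by have := max_poly_roots p0 (introT allP rp) urs; rewrite size_map size_iota ltnn.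
Qed.

(** Take x on the curve of the sums of t^i v_i. Each root is a nonzero polynomial in t there, and
    some t avoids the zeros of their product. Being in the span of [vs], x is fixed by whatever
    fixes [vs]. *)
Lemma exists_regular vs : {in Phi, forall a, exists2 v, v \in vs & B a v != 0} ->
  exists2 x, regular x & forall s, {in vs, forall v, s @@ v = v} -> s @@ x = x.
Proof.
move=> Pvs; pose p a := \poly_(i < size vs) B a vs`_i.
have [|t] := @poly_nonroot (\prod_(a <- Phi) p a).
  rewrite prodf_seq_neq0; apply/allP => a /Pvs[v vvs] /=; apply: contraNneq => /(congr1 (coefp (index v vs))).
  by rewrite /= coef_poly index_mem vvs nth_index // coef0 => ->.
rewrite horner_prod => nz; exists (\sum_(i < size vs) t ^+ i *: vs`_i).
  move=> a aP; apply: contraNneq nz.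
  rewrite B_sumr => e; rewrite (big_rem a) //= horner_poly.
  rewrite (eq_bigr (fun i : 'I__ => B a (t ^+ i *: vs`_i))) ?e ?mul0r //.
  by move=> i _; rewrite BZr mulrC.
move=> s svs; rewrite refls_sum; apply: eq_bigr => i _.
by rewrite reflsZ svs ?mem_nth.
Qed.

(** * Orbits of a Coxeter element *)

Definition cox e : V -> V := fun x => e @@ x.

Lemma iter_cox e k x : iter k (cox e) x = flatten (nseq k e) @@ x.
Proof. by elim: k => //= k ->; rewrite refls_cat. Qed.

Lemma sub_word e k : {subset e <= b} -> {subset flatten (nseq k e) <= b}.
Proof. by move=> eb z /flattenP[t]; rewrite mem_nseq => /andP[_ /eqP->]; apply: eb. Qed.

Lemma refls_om s y : {subset s <= b} -> y \in b -> y \notin s -> s @@ om y = om y.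
Proof.
move=> + yb; elim: s => //= z s IH sb; rewrite inE negb_or => /andP[yz ys].
have zb : z \in b by apply/sb/mem_head.
rewrite IH // => [|u us]; last by apply: sb; rewrite inE us orbT.
by rewrite refl_id // om_dual // eq_sym (negPf yz).
Qed.

(** Only the first letter y can change the coefficient of y, as the letters are distinct. Comparing
    this coefficient in a fixed vector gives [B y x = 0], and y drops out of the word. *)
Lemma cox_fixed e x : uniq e -> {subset e <= b} -> cox e x = x ->
  {in e, forall y, B y x = 0}.
Proof.
rewrite /cox; elim: e => //= y s IH /andP[ys us] sb ex.
have yb : y \in b by apply/sb/mem_head.
have {}sb : {subset s <= b} by move=> z zs; apply: sb; rewrite inE zs orbT.
have es : s @@ x = refl y x by rewrite -[X in refl y X]ex reflK ?Phi2 ?b_root.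
have yx : B y x = 0.
  have : B (s @@ x) (om y) = B x (om y).
    by rewrite B_refls refls_om ?mem_rev // => z; rewrite mem_rev; apply: sb.
  by rewrite es /refl BDl BNl BZl om_id // mulr1; lra.
move=> z; rewrite inE => /predU1P[->//|]; apply: IH => //.
by rewrite es refl_id.
Qed.

Section Coxeter.
Variables (e : seq V) (h : nat).
Hypothesis e_b : perm_eq e b.
Hypothesis e_h : has_order (cox e) h.

Lemma e_sub : {subset e <= b}.
Proof. by move=> z; rewrite (perm_mem e_b). Qed.

Lemma iter_root k a : a \in Phi -> iter k (cox e) a \in Phi.
Proof. by move=> aP; rewrite iter_cox; apply/refls_root/aP/sub_root/sub_word/e_sub. Qed.

Lemma iter_mod n x : iter n (cox e) x = iter (n %% h) (cox e) x.
Proof. by apply: iter_modn; case: e_h. Qed.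

Lemma iter_h n x : iter (h * n) (cox e) x = x.
Proof. by rewrite iter_mod modnMr. Qed.

Lemma h_gt0 : (0 < h)%N. Proof. by case: e_h. Qed.

(** The sum is fixed by the Coxeter element, hence orthogonal to every simple root. *)
Lemma orbit_sum0 a : \sum_(k < h) iter k (cox e) a = 0.
Proof.
apply: B_simple_eq0 => y yb.
apply: (@cox_fixed e); rewrite ?(perm_mem e_b) ?(perm_uniq e_b) //; first exact: e_sub.
rewrite /cox refls_sum; case: h h_gt0 (iter_h 1 a) => // n _; rewrite muln1 => e1.
rewrite [RHS]big_ord_recl big_ord_recr /= addrC; congr (_ + _).
by rewrite -[RHS]e1.
Qed.

Lemma orbit_not_pos a : a \in Phi -> ~ (forall k, pos (iter k (cox e) a)).
Proof.
move=> aP p; have := root_nz aP; case/eqP; apply: coef_eq => y yb.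
have := orbit_sum0 a; move/(congr1 (B^~ (om y))); rewrite B0l B_suml => /eqP.
rewrite psumr_eq0 => [|i _]; last exact: p.
by move/allP/(_ (Ordinal h_gt0)); rewrite mem_index_enum => /(_ isT)/eqP.
Qed.

Lemma orbit_split a : a \in Phi -> exists k t1 y t2,
  e = t1 ++ y :: t2 /\ iter k (cox e) a = t1 @@ y.
Proof.
move=> aP; apply: contrapT => H.
(* Negativity persists along the orbit: a passage from negative to positive is undone by [rev e],
   and the letter at which the sign turns exhibits the positive root as some t1 @@ y, which is
   excluded. *)
have step k : pos (- iter k (cox e) a) -> pos (- iter k.+1 (cox e) a).
  move=> n; have kP := iter_root k aP; have [p|//] := root_pos (iter_root k.+1 aP).
  have e'b : {subset rev e <= b} by move=> z; rewrite mem_rev; apply: e_sub.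
  have := word_neg_split e'b (iter_root k.+1 aP) p.
  rewrite iterS {1}/cox refls_revK; last exact/sub_root/e_sub.
  move=> /(_ n)[s1 [y [s2 [es ey]]]]; case: H; exists k.+1, (rev s2), y, (rev s1).
  split; first by rewrite -[e]revK es rev_cat rev_cons cat_rcons.
  rewrite -ey refls_revK // => z zs; apply/b_root/e'b.
  by rewrite es mem_cat inE zs !orbT.
have [[k n]|np] := pselect (exists k, pos (- iter k (cox e) a)).
  apply: (orbit_not_pos (root_opp (iter_root k aP))) => j.
  rewrite iter_cox reflsN -iter_cox -iterD addnC.
  by elim: j => [|j IH]; rewrite ?addn0 // addnS; apply: step.
apply: (orbit_not_pos aP) => k; have [//|n] := root_pos (iter_root k aP).
by case: np; exists k.
Qed.

Lemma B_iter k x y : B (iter k (cox e) x) (iter k (cox e) y) = B x y.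
Proof. by rewrite !iter_cox B_refls2 //; apply/sub_root/sub_word/e_sub. Qed.

(** The adjoint of c^k is its inverse, written as the forward power c^((h-1)k). *)
Lemma B_iter_dual k a v :
  B (iter k (cox e) a) v = B a (iter (h.-1 * k) (cox e) v).
Proof.
rewrite -(B_iter (h.-1 * k)) -iterD -mulSnr prednK ?h_gt0 //.
by rewrite iter_h.
Qed.

Lemma orbit_cover v : {in Phi, forall a, exists k, B (iter k (cox e) a) v = 1} ->
  let S := [seq iter j (cox e) v | j <- iota 0 h] in
  uniq S /\ {in Phi, forall a, exists2 x, x \in S & B a x = 1}.
Proof.
move=> cov S; have covS : {in Phi, forall a, exists2 x, x \in S & B a x = 1}.
  move=> a /cov[k]; rewrite B_iter_dual iter_mod => e1.
  by eexists; last exact: e1; apply: map_f; rewrite mem_iota /= ltn_mod h_gt0.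
split=> //; rewrite map_inj_in_uniq ?iota_uniq //.
suff H i j : (i < j < h)%N -> iter i (cox e) v <> iter j (cox e) v.
  move=> i j; rewrite !mem_iota /= !add0n => ih jh eij.
  by case: (ltngtP i j) => // l; [case: (@H i j)|case: (@H j i)]; rewrite ?l.
case/andP=> ij jh eij; pose k := (j - i)%N.
have kv : iter k (cox e) v = v.
  have : iter (h - i) (cox e) (iter i (cox e) v) = iter (h - i) (cox e) (iter j (cox e) v) by rewrite eij.
  rewrite -!iterD subnK; last by lia.
  rewrite -{1}[h]muln1 iter_h => ev; rewrite [RHS]ev.
  have -> : (h - i + j = h * 1 + k)%N by rewrite /k; lia.
  by rewrite iterD iter_h.
have [x rx fx] : exists2 x, regular x &
    forall s, {in S, forall v, s @@ v = v} -> s @@ x = x.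
  apply: exists_regular => a /covS[x xS ax]; exists x => //.
  by rewrite ax oner_eq0.
have [_ _ /(_ k)] := e_h; apply; first by rewrite /k; lia.
move=> u; rewrite iter_cox; apply: (regular_stab _ rx); first exact/sub_word/e_sub.
(* Powers of c commute, so c^k fixes the whole orbit as soon as it fixes v. *)
by apply: fx => _ /mapP[l _ ->]; rewrite -iter_cox -iterD addnC iterD kv.
Qed.
End Coxeter.

(** * Connectedness of the Dynkin diagram *)

Lemma B_sum_int s y : {subset s <= b} -> y \in b ->
  B (\sum_(z <- s) z) y \is a Num.int.
Proof.
move=> sb yb; rewrite B_suml big_seq; apply: rpred_sum => z zs.
by apply: Phi_int; apply: b_root => //; apply: sb.
Qed.

Lemma norm_sum_even s : {subset s <= b} ->
  exists n : int, B (\sum_(z <- s) z) (\sum_(z <- s) z) = 2 * n%:~R.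
Proof.
elim: s => [|y s IH] sb; first by exists 0; rewrite big_nil B0r mulr0.
have yb : y \in b by apply/sb/mem_head.
have {}sb : {subset s <= b} by move=> z zs; apply: sb; rewrite inE zs orbT.
have [n en] := IH sb; have /intrP[k ek] := B_sum_int sb yb.
exists (1 + k + n); rewrite big_cons !BDl !BDr (BC y (\sum_(z <- s) z)) ek en.
by rewrite Phi2 ?b_root // !rmorphD /=; ring.
Qed.

(** The root lattice is even. The parts of [a] inside and outside [p] are orthogonal lattice vectors
    with even norms of sum 2, so one of them is 0. *)
Lemma root_component (p : pred V) a :
  {in b &, forall x y, p x -> ~~ p y -> B x y = 0} -> a \in Phi ->
  {in b, forall y, p y -> B a (om y) = 0} \/
  {in b, forall y, ~~ p y -> B a (om y) = 0}.
Proof.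
move=> orth; wlog pa : a / pos a => [H aP|aP].
  have [pa|na] := root_pos aP; first exact: H.
  by have [H1|H1] := H _ na (root_opp aP); [left|right] => y yb py;
    apply/eqP; rewrite -oppr_eq0 -BNl H1.
have [s sb ea] := root_seq aP pa.
pose x1 := \sum_(z <- s | p z) z; pose x2 := \sum_(z <- s | ~~ p z) z.
have e12 : a = x1 + x2 by rewrite ea (bigID p).
have sub q : {subset [seq z <- s | q z] <= b}.
  by move=> z; rewrite mem_filter => /andP[_ /sb].
have coef0 q y : y \in b -> ~~ q y -> B (\sum_(z <- s | q z) z) (om y) = 0.
  move=> yb qy; rewrite B_suml big_seq_cond big1 // => z /andP[zs qz].
  have zb := sb z zs; rewrite om_dual //; have [zy|//] := eqVneq z y.
  by rewrite -zy qz in qy.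
have o12 : B x1 x2 = 0.
  rewrite B_suml big_seq_cond big1 // => z /andP[zs pz].
  by rewrite B_sumr big_seq_cond big1 // => w /andP[ws pw]; apply: orth; rewrite ?sb.
have [n1 en1] : exists n : int, B x1 x1 = 2 * n%:~R.
  by have := norm_sum_even (sub p); rewrite big_filter.
have [n2 en2] : exists n : int, B x2 x2 = 2 * n%:~R.
  by have := norm_sum_even (sub (predC p)); rewrite big_filter.
have := Phi2 aP; rewrite e12 BDl !BDr (BC x2 x1) o12 en1 en2.
have := B_ge0 x1; have := B_ge0 x2; rewrite en1 en2 => g2 g1 e2.
have {}g1 : (0 <= n1%:~R :> R) by lra.
have {}g2 : (0 <= n2%:~R :> R) by lra.
have {e2} : (n1 + n2)%:~R = 1%:~R :> R by rewrite rmorphD /=; lra.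
move/intr_inj; rewrite !ler0z in g1 g2 => e1.
have [n0|n0] : n1 = 0 \/ n2 = 0 by lia.
- left=> y yb py; have x0 : x1 = 0 by apply: B_eq0; rewrite en1 n0 mulr0.
  by rewrite x0 add0r coef0 // negbK.
- right=> y yb py; have x0 : x2 = 0 by apply: B_eq0; rewrite en2 n0 mulr0.
  by rewrite x0 addr0 coef0.
Qed.

(** Were the diagram split by [p], each root would be supported on one side, and the roots supported
    in [p] would be orthogonal to all others, against irreducibility. *)
Lemma simple_connected (p : pred V) : has p b -> has (predC p) b ->
  exists x y, [/\ x \in b, y \in b, p x, ~~ p y & B x y = -1].
Proof.
move=> /hasP[x0 x0b px0] /hasP[y0 y0b py0]; apply: contrapT => H.
have orth : {in b &, forall x y, p x -> ~~ p y -> B x y = 0}.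
  move=> x y xb yb px py; have xy : x != y by apply: contraNneq py => <-.
  by have [//|e1] := simple_B xb yb xy; case: H; exists x, y.
pose q a := all (fun y => p y || (B a (om y) == 0)) b.
have [||a [a' [aP a'P qa qa' []]]] := Phi_irr (p := q).
- apply/hasP; exists x0; first exact: b_root.
  apply/allP => y yb; rewrite om_dual //; case: (eqVneq x0 y) => [<-|_]; first by rewrite px0.
  by rewrite eqxx orbT.
- apply/hasP; exists y0; first exact: b_root.
  apply/allPn; exists y0 => //; rewrite om_id // oner_eq0 orbF; exact: py0.
have {}qa' : {in b, forall y, p y -> B a' (om y) = 0}.
  have [//|q'] := root_component orth a'P; case/negP: qa'; apply/allP => y yb.
  by case: (boolP (p y)) => //= py; rewrite q'.
rewrite (b_expand a) (b_expand a') B_suml big_seq big1 // => x xb.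
rewrite B_sumr big_seq big1 // => y yb; rewrite BZl BZr.
have [py|py] := boolP (p y); first by rewrite (qa' y yb py); ring.
have [px|px] := boolP (p x); first by rewrite (orth x y xb yb px py); ring.
by have /allP/(_ x xb) := qa; rewrite (negPf px) => /eqP->; rewrite mul0r.
Qed.

(* The order in which a connected subdiagram is enumerated vertex by vertex;
   the partial sums are then roots. *)
Inductive growing r : seq V -> Prop :=
| growing1 : growing r [:: r]
| growing_rcons t x of growing r t & x \in b & x \notin t
    & B (\sum_(y <- t) y) x = -1 : growing r (rcons t x).

Section Growing.
Variable r : V.
Hypothesis rb : r \in b.

Lemma growing_sub t : growing r t -> {subset t <= b}.
Proof.
elim=> [y|{}t x _ IH xb _ _ y]; first by rewrite inE => /eqP->.
by rewrite mem_rcons inE => /predU1P[->|/IH].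
Qed.

Lemma growing_uniq t : growing r t -> uniq t.
Proof. by elim=> // {}t x _ IH _ xt _; rewrite rcons_uniq xt. Qed.

Lemma growing_mem t : growing r t -> r \in t.
Proof. by elim=> [|{}t x _ IH _ _ _]; rewrite ?mem_head // mem_rcons inE IH orbT. Qed.

Lemma growing_root t : growing r t -> \sum_(y <- t) y \in Phi.
Proof.
elim=> [|{}t x _ IH xb _ e1]; first by rewrite big_seq1 b_root.
have := Phi_refl (b_root xb) IH.
by rewrite /refl BC e1 scaleN1r opprK -cats1 big_cat big_seq1.
Qed.

(** Connectedness supplies a y outside [t] with a neighbour in [t]. The sum of [t] is a positive
    root with negative pairing with y, so the pairing is -1: y has a single neighbour in [t]. This
    is how the diagram is seen to be a tree. *)
Lemma growing_full : exists2 e, growing r e & perm_eq e b.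
Proof.
have [t gt st] : exists2 t, growing r t & size t = (size b).-1.+1.
  have : ((size b).-1 < size b)%N by case: b rb.
  elim: (size b).-1 => [|n IH] lt_n; first by exists [:: r] => //; apply: growing1.
  have [t gt st] := IH (ltnW lt_n).
  have [||x [y [xb yb xt yt xy]]] := @simple_connected (mem t).
  - by apply/hasP; exists r => //; apply: growing_mem.
  - rewrite has_predC; apply/negP => /allP bt.
    by have := uniq_leq_size b_uniq bt; rewrite st leqNgt lt_n.
  exists (rcons t y); last by rewrite size_rcons st.
  apply: growing_rcons => //.
  have lt0 : B (\sum_(z <- t) z) y < 0.
    rewrite B_suml (big_rem x) //= xy big_seq.
    suff : \sum_(z <- rem x t | z \in rem x t) B z y <= 0 by lra.
    apply: sumr_le0 => z /mem_rem zt; apply: simple_B_le0 => //.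
      exact: (growing_sub gt).
    by apply: contraTneq zt => ->.
  have tP := growing_root gt; have yP := b_root yb.
  have [te|te|[]] := root_B_cases tP yP; rewrite ?te //; try lra.
    by move: lt0; rewrite te Phi2 //; lra.
  have /(pos_neq_neg yP (pos_b yb)) // : pos (- y).
  by rewrite -te; apply/pos_sum/growing_sub.
exists t => //; rewrite prednK in st; last by case: b rb.
apply: uniq_perm => //; first exact: growing_uniq.
by apply: (uniq_min_size (growing_uniq gt) (growing_sub gt) _).2; rewrite st.
Qed.

Lemma growing_split t1 y t2 : growing r (t1 ++ y :: t2) ->
  t1 = [::] /\ y = r \/ [/\ growing r t1, B (\sum_(z <- t1) z) y = -1 & y != r].
Proof.
elim/last_ind: t2 => [|t2 x IH].
  rewrite cats1; move E : (rcons t1 y) => s gs; case: gs E => [|t x gt xb xt e1].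
    by case: t1 => [|? []] //= [->]; left.
  move/rcons_inj => [-> ->]; right; split=> //.
  by apply: contraNneq xt => ->; apply: growing_mem.
rewrite -rcons_cons -rcons_cat; move E : (rcons _ x) => s gs.
case: gs E => [|t z gt zb zt e1]; first by case: t1 {IH} => [|? []] //= [_]; case: t2.
by move/rcons_inj => [e _]; apply: IH; rewrite e.
Qed.

(** Each new letter x pairs to 1 with the current vector, since it pairs to -1 with the sum already
    subtracted; so x is subtracted in turn. *)
Lemma growing_om t : growing r t -> rev t @@ om r = om r - \sum_(y <- t) y.
Proof.
elim=> [|{}t x gt IH xb xt e1]; first by rewrite /= /refl om_id // scale1r big_seq1.
rewrite rev_rcons /= IH -cats1 big_cat big_seq1 /= /refl BDr BNr (BC x (\sum_(y <- t) y)) e1.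
rewrite om_dual // (_ : (x == r) = false) ?mulr0n ?sub0r ?opprK ?scale1r ?opprD ?addrA //.
by apply: contraNF xt => /eqP->; apply: growing_mem.
Qed.

Lemma growing_B_om t1 y t2 : growing r (t1 ++ y :: t2) -> B (t1 @@ y) (om r) = 1.
Proof.
move=> g; have yb : y \in b by apply: (growing_sub g); rewrite mem_cat mem_head orbT.
have [[-> ->]|[g1 e1 yr]] := growing_split g; first exact: om_id.
by rewrite B_refls growing_om // BDr BNr om_dual // (negPf yr) (BC y) e1 mulr0n; lra.
Qed.
End Growing.

Lemma refls_fixed s x : {in s, forall y, B y x = 0} -> s @@ x = x.
Proof.
elim: s => //= y s IH H; rewrite IH => [|z zs]; last by apply: H; rewrite inE zs orbT.
by rewrite refl_id // H ?mem_head.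
Qed.

(** The system is triangular: once the letters before y are orthogonal to x, they fix x, and t1 @@ y
    has the same pairing with x as y. *)
Lemma theta_span e x : {subset e <= b} ->
  (forall t1 y t2, e = t1 ++ y :: t2 -> B (t1 @@ y) x = 0) ->
  {in e, forall y, B y x = 0}.
Proof.
move=> eb H; suff H' : forall t1 t2, e = t1 ++ t2 -> {in t1, forall y, B y x = 0}.
  by apply: (H' e [::]); rewrite cats0.
elim/last_ind=> // t y IH t2 et z.
have {}IH := IH (y :: t2); rewrite -cat_rcons in IH; have {}IH := IH et.
rewrite mem_rcons inE => /predU1P[->|/IH//].
have := H t y t2; rewrite -cat_rcons => /(_ et); rewrite B_refls refls_fixed //.
by move=> u; rewrite mem_rev; apply: IH.
Qed.

Lemma minuscule_cover r e h : r \in b -> growing r e -> perm_eq e b ->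
  has_order (cox e) h -> {in Phi, forall a, B a (om r) <= 1} ->
  {in Phi, forall a, exists k, B (iter k (cox e) a) (om r) = 1} /\
  (forall x, {in Phi, forall a, B a (om r) = 1 -> B a x = 0} -> x = 0).
Proof.
move=> rb ge eb eh le1; split=> [a aP|x Hx].
  have [k [t1 [y [t2 [et ek]]]]] := orbit_split eb eh aP.
  by exists k; rewrite ek; rewrite et in ge; apply: (growing_B_om rb ge).
apply: B_simple_eq0 => y; rewrite -(perm_mem eb); apply: theta_span y.
  exact: (growing_sub rb ge).
move=> t1 y t2 et; rewrite et in ge; apply: Hx; last exact: (growing_B_om rb ge).
have sub := growing_sub rb ge.
by apply: refls_root => [u us|]; apply/b_root/sub; rewrite mem_cat ?us // mem_head orbT.
Qed.

(** * Conjugacy of Coxeter elements *)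

Section Reordering.
Variables (K Q : (V -> V) -> Prop).
Hypothesis K_comp : forall f f', K f -> K f' -> K (f \o f').
Hypothesis K_id : K id.
Hypothesis Q_rot : forall f f', K f -> K f' -> Q (f \o f') -> Q (f' \o f).
Implicit Types G : V -> V -> V.

(** Letters stand for arbitrary maps, because merging turns a letter into a product of reflections.
    [Q] will be having order [h], which is invariant under rotation for factors in the class [K] of
    surjective maps. *)
Let word G s : V -> V := foldr (fun y f => G y \o f) id s.

Lemma word_cat G s t : word G (s ++ t) = word G s \o word G t.
Proof. by elim: s => //= y s ->. Qed.

Lemma word_K G s : {in s, forall y, K (G y)} -> K (word G s).
Proof.
elim: s => //= y s IH Ks; apply: K_comp; first by apply/Ks/mem_head.
by apply: IH => z zs; apply: Ks; rewrite inE zs orbT.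
Qed.

Lemma word_comm G f s : {in s, forall y, f \o G y = G y \o f} ->
  f \o word G s = word G s \o f.
Proof.
elim: s => //= y s IH Cs.
rewrite [LHS](_ : _ = (f \o G y) \o word G s) // Cs ?mem_head //.
rewrite [LHS](_ : _ = G y \o (f \o word G s)) // IH // => z zs.
by apply: Cs; rewrite inE zs orbT.
Qed.

Lemma eq_word G G' s : {in s, G =1 G'} -> word G s = word G' s.
Proof.
elim: s => //= y s IH E; rewrite E ?mem_head // IH // => z zs.
by apply: E; rewrite inE zs orbT.
Qed.

(** All pairings of x with [t] are 0 or -1, so a sum of -1 has exactly one nonzero term. *)
Lemma growing_leaf r t x : r \in b -> growing r t -> x \in b -> x \notin t ->
  B (\sum_(y <- t) y) x = -1 ->
  exists2 y, y \in t & {in t, forall z, z != y -> B x z = 0}.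
Proof.
move=> rb gt xb xt e1; have tb := growing_sub rb gt.
have tx z : z \in t -> B z x <= 0.
  by move=> zt; apply: simple_B_le0 => //; [apply: tb|apply: contraNneq xt => <-].
have [/hasP[y yt yx]|/hasPn t0] := boolP (has (fun y => B y x != 0) t); last first.
  move: e1; rewrite B_suml big_seq big1 => [/eqP|z /t0]; last by rewrite negbK => /eqP.
  by rewrite eq_sym oppr_eq0 oner_eq0.
exists y => // z zt zy.
have yx1 : B y x = -1.
  have [/eqP|//] : B y x = 0 \/ B y x = -1; last by rewrite (negPf yx).
  by apply: simple_B => //; [apply: tb|apply: contraNneq xt => <-].
move: e1; rewrite B_suml (big_rem y) //= yx1 => /eqP.
rewrite -subr_eq0 addrAC subrr add0r -oppr_eq0 -sumrN big_seq psumr_eq0; last first.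
  by move=> u /mem_rem ut; rewrite oppr_ge0 tx.
move/allP/(_ z); rewrite BC (mem_rem_uniq _ (growing_uniq gt)) !inE zy zt.
by rewrite oppr_eq0 => /(_ isT)/implyP/(_ isT)/eqP.
Qed.

(* Rotating the word and commuting letters brings the leaf [x] just behind its
   only neighbour [y]; merging [G y \o G x] into one letter removes [x] from the
   diagram. *)
Lemma growing_word G r t s : r \in b -> growing r t -> {in t, forall y, K (G y)} ->
  {in t &, forall y z, B y z = 0 -> G y \o G z = G z \o G y} ->
  perm_eq s t -> Q (word G s) -> Q (word G t).
Proof.
move=> rb gt; elim: gt G s => [|{}t x gt IH xb xt e1] G s KG CG st.
  by have /perm_small_eq -> := st.
have [y yt xN] := growing_leaf rb gt xb xt e1.
have xt' : x \in rcons t x by rewrite mem_rcons mem_head.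
have tt' z : z \in t -> z \in rcons t x by rewrite mem_rcons inE orbC => ->.
have CGx z : z \in t -> z != y -> G x \o G z = G z \o G x.
  by move=> zt zy; apply: CG => //; [apply: tt'|apply: xN].
pose G' z := if z == y then G y \o G x else G z.
have G'E z : z != y -> G' z = G z by rewrite /G' => /negPf->.
have G'y : G' y = G y \o G x by rewrite /G' eqxx.
have ut := growing_uniq gt.
have xs : x \in s by rewrite (perm_mem st).
have us : uniq s by rewrite (perm_uniq st) rcons_uniq xt.
have st' : perm_eq (rem x s) t.
  by rewrite -(perm_cons x) -(permPl (perm_to_rem xs)) (permPl st) perm_rcons.
have merge (u1 u2 : seq V) : uniq (u1 ++ y :: u2) -> {subset u1 ++ y :: u2 <= t} ->
    word G' (u1 ++ y :: u2) = word G u1 \o G y \o G x \o word G u2.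
  rewrite cat_uniq /= => /and3P[_ /norP[yu1 _] /andP[yu2 _]] ut'.
  rewrite word_cat /= G'y (@eq_word _ G u1) ?(@eq_word _ G u2) //.
    by move=> z zu; rewrite G'E //; apply: contraNneq yu2 => <-.
  by move=> z zu; rewrite G'E //; apply: contraNneq yu1 => <-.
have comm (u : seq V) : {subset u <= t} -> y \notin u -> G x \o word G u = word G u \o G x.
  move=> ut' yu; apply: word_comm => z zu; apply: CGx; first exact: ut'.
  by apply: contraNneq yu => <-.
have Et : word G (rcons t x) = word G' t.
  have [u1 [u2 et]] : exists u1 u2 : seq V, t = u1 ++ y :: u2.
    by case/splitPr: yt => u1 u2; exists u1, u2.
  rewrite -cats1 {1}et -catA word_cat /= word_cat et merge -?et //=.
  rewrite -[RHS]/(word G u1 \o G y \o (G x \o word G u2)) comm //.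
  - by move=> z zu; rewrite et mem_cat inE zu !orbT.
  - by move: ut; rewrite et cat_uniq /= => /and3P[_ _ /andP[]].
rewrite Et => Qs; apply: (IH G' _ _ _ st').
- move=> z zt; rewrite /G'; case: ifP => _; last by apply/KG/tt'.
  by apply: K_comp; apply: KG => //; apply: tt'.
- move=> z w zt wt zw; rewrite /G'; case: ifPn => [/eqP zy|zy]; case: ifPn => [/eqP wy|wy] //.
  + have yw : G y \o G w = G w \o G y by apply: CG; [apply: tt'|apply: tt'|rewrite -zy].
    rewrite -[LHS]/(G y \o (G x \o G w)) CGx // -[LHS]/((G y \o G w) \o G x) yw.
    by [].
  + have yz : G z \o G y = G y \o G z by apply: CG; [apply: tt'|apply: tt'|rewrite -wy].
    rewrite -[LHS]/((G z \o G y) \o G x) yz -[LHS]/(G y \o (G z \o G x)) -CGx //.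
  + by apply: CG => //; apply: tt'.
have ys' : y \in rem x s by rewrite (perm_mem st').
have us' : uniq (rem x s) by rewrite rem_uniq.
have sub' : {subset rem x s <= t} by move=> z; rewrite (perm_mem st').
have [s1 [s2 es]] : exists s1 s2, s = s1 ++ x :: s2.
  by case/splitPr: xs => s1 s2; exists s1, s2.
have er : rem x s = s1 ++ s2.
  have : x \notin s1.
    by apply: contraTN us => xs1; rewrite es cat_uniq /= xs1 andbF.
  rewrite {1}es; elim: (s1) => [|z u IHu] /=; first by rewrite eqxx.
  by rewrite inE negb_or eq_sym => /andP[/negPf-> /IHu->].
have sub12 : {subset s1 ++ s2 <= t} by rewrite -er.
have sub1 : {subset s1 <= t} by move=> z zs; apply: sub12; rewrite mem_cat zs.
have sub2 : {subset s2 <= t} by move=> z zs; apply: sub12; rewrite mem_cat zs orbT.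
have u12 : uniq (s1 ++ s2) by rewrite -er.
rewrite er; move: ys'; rewrite er mem_cat => /orP[ys1|ys2].
  have [p1 [p2 ep]] : exists p1 p2, s1 = p1 ++ y :: p2.
    by case/splitPr: ys1 => p1 p2; exists p1, p2.
  have {}Qs : Q (word G p1 \o G y \o (word G p2 \o G x) \o word G s2).
    by move: Qs; rewrite es ep !word_cat.
  rewrite -comm in Qs; first 1 last.
  - by move=> z zp; apply: sub1; rewrite ep mem_cat inE zp !orbT.
  - by move: u12; rewrite ep -catA cat_uniq /= => /and3P[_ _ /andP[]]; rewrite mem_cat negb_or => /andP[].
  rewrite ep -catA /= merge ?word_cat //.
  - by move: u12; rewrite ep -catA.
  - by move: sub12; rewrite ep -catA.
(* Here x precedes y. The words s1 and then x are rotated to the end, x is commuted leftwards past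
   s1 and p2 up to y, and s1 is rotated back to the front. *)
have [p1 [p2 ep]] : exists p1 p2, s2 = p1 ++ y :: p2.
  by case/splitPr: ys2 => p1 p2; exists p1, p2.
have Kw (u : seq V) : {subset u <= t} -> K (word G u).
  by move=> ut'; apply: word_K => z /ut' zt; apply/KG/tt'.
have Ky : K (G y) by apply/KG/tt'.
have Kx : K (G x) by apply: KG.
have subp1 : {subset p1 <= t} by move=> z zp; apply: sub2; rewrite ep mem_cat zp.
have subp2 : {subset p2 <= t} by move=> z zp; apply: sub2; rewrite ep mem_cat inE zp !orbT.
have yp2 : y \notin p2.
  by move: u12; rewrite ep cat_uniq cat_uniq /= => /and3P[_ _ /and3P[_ _ /andP[]]].
have ys1 : y \notin s1.
  apply: contraTN u12 => ys1; rewrite ep cat_uniq; apply/negP => /and3P[_ /hasP[]].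
  by exists y => //; rewrite mem_cat mem_head orbT.
have Kp : K (word G p1 \o G y \o word G p2) by do !apply: K_comp => //; apply: Kw.
have Ks1 : K (word G s1) by apply: Kw.
move: Qs; rewrite es ep word_cat /= word_cat /= => /Q_rot Qs.
have {}Qs : Q (G x \o (word G p1 \o G y \o word G p2 \o word G s1)).
  by apply: Qs => //; apply: K_comp.
have {Qs} : Q ((word G p1 \o G y \o word G p2 \o word G s1) \o G x).
  by apply: Q_rot Qs => //; apply: K_comp.
rewrite -[X in Q X]/(word G p1 \o G y \o word G p2 \o (word G s1 \o G x)) -comm //.
rewrite -[X in Q X]/(word G p1 \o G y \o (word G p2 \o G x) \o word G s1) -comm //.
move=> /Q_rot Qs; rewrite catA merge; first 1 last.
- by rewrite -catA -ep.
- by rewrite -catA -ep.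
rewrite word_cat; apply: Qs => //; do !apply: K_comp => //; exact: Kw.
Qed.
End Reordering.

(** The map f' intertwines the powers of the two products, and f does so in the other direction;
    surjectivity lets them reach every vector. *)
Lemma has_order_rot h (f f' : V -> V) : (forall x, exists y, f y = x) ->
  (forall x, exists y, f' y = x) -> has_order (f \o f') h -> has_order (f' \o f) h.
Proof.
have rot k (f1 f2 : V -> V) x : iter k (f2 \o f1) (f2 x) = f2 (iter k (f1 \o f2) x).
  by elim: k => //= k ->.
move=> sf sf' [h0 h1 hk]; split=> // [x|k kh H].
  by have [y <-] := sf' x; rewrite rot h1.
by apply: (hk k kh) => x; have [y <-] := sf x; rewrite rot H.
Qed.

Lemma cox_word e : cox e = foldr (fun y f => refl y \o f) id e.
Proof. by apply: funext; elim: e => //= y e IH x; rewrite /cox /= -IH. Qed.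

Lemma growing_order r e s h : r \in b -> growing r e -> perm_eq s e ->
  has_order (cox s) h -> has_order (cox e) h.
Proof.
move=> rb ge se; rewrite !cox_word.
apply: (@growing_word (fun f => forall x, exists y, f y = x) (fun f => has_order f h) _ _ _ refl r) se => //.
- by move=> f f' sf sf' x; have [y <-] := sf x; have [z <-] := sf' y; exists z.
- by move=> x; exists x.
- exact: has_order_rot.
- move=> y /(growing_sub rb ge) yb x; exists (refl y x).
  exact: reflK (Phi2 (b_root yb)) x.
- by move=> y z _ _ yz; apply: funext => x /=; apply: refl_comm.
Qed.

(** * The highest root *)

Lemma seq_max (f : V -> R) s x0 : x0 \in s ->
  exists2 x, x \in s & {in s, forall y, f y <= f x}.
Proof.
elim: s x0 => // x s IH x0 _; case: s IH => [_|y s /(_ y (mem_head _ _))[z zs zmax]].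
  by exists x; rewrite ?mem_head // => y; rewrite inE => /eqP->.
have [fxz|fzx] := leP (f x) (f z).
  exists z => [|u]; first by rewrite inE zs orbT.
  by rewrite inE => /predU1P[->|/zmax].
exists x => [|u]; first exact: mem_head.
by rewrite inE => /predU1P[->//|/zmax le_u]; apply: le_trans le_u (ltW fzx).
Qed.

Definition dominant x := {in b, forall y, 0 <= B y x}.

(** Among the roots above [a], one with the largest coefficient sum is dominant: if a simple y had
    negative pairing with it, adding y would give a larger root. *)
Lemma root_dominant_above a : a \in Phi -> pos a -> exists x,
  [/\ x \in Phi, dominant x & {in b, forall y, B a (om y) <= B x (om y)}].
Proof.
move=> aP pa; pose L := [seq x <- Phi | all (fun y => B a (om y) <= B x (om y)) b].
have [|x] := @seq_max (fun x => \sum_(y <- b) B x (om y)) L a.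
  by rewrite mem_filter aP andbT; apply/allP => y _.
rewrite mem_filter => /andP[/allP ax xP] xmax.
have px : pos x by move=> y yb; apply: le_trans (pa y yb) (ax y yb).
exists x; split=> // y yb; have yP := b_root yb; rewrite leNgt; apply/negP => lt0.
have [yx|yx|[]yx] := root_B_cases yP xP; try lra.
- by move: lt0; rewrite yx Phi2 //; lra.
- by have := pos_b yb; rewrite yx; apply: pos_neq_neg.
have xyP : x + y \in Phi by have := Phi_refl yP xP; rewrite /refl yx scaleN1r opprK.
have /xmax : x + y \in L.
  rewrite mem_filter xyP andbT; apply/allP => z zb; rewrite BDl (om_dual yb zb).
  by apply: le_trans (ax z zb) _; rewrite lerDl.
under eq_bigr => z _ do rewrite BDl.
rewrite big_split /= gerDl (big_rem y) //= om_id // big_seq.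
have : 0 <= \sum_(i <- rem y b | i \in rem y b) B y (om i).
  by apply: sumr_ge0 => i /mem_rem ib; rewrite om_dual.
by lra.
Qed.

(** Otherwise connectedness gives a simple w outside the support but adjacent to it, and w has
    negative pairing with x. *)
Lemma dominant_pos x : x \in Phi -> dominant x -> pos x ->
  {in b, forall y, 0 < B x (om y)}.
Proof.
move=> xP dx px y yb; rewrite lt_neqAle px // andbT; apply/negP => /eqP/esym y0.
pose p z := B x (om z) != 0.
have [||z [w [zb wb pz pw zw]]] := @simple_connected p.
- apply: contraT => /hasPn H; have := root_nz xP; case/eqP.
  by apply: coef_eq => z /H; rewrite /p negbK B0l => /eqP.
- by apply/hasP; exists y; rewrite // /p /= y0 eqxx.
have := dx w wb; rewrite (b_expand x) B_sumr (big_rem z) //= BZr (BC w z) zw big_seq.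
suff : \sum_(i <- rem z b | i \in rem z b) B w (B x (om i) *: i) <= 0.
  by have := px z zb; rewrite le_eqVlt eq_sym (negPf pz) /=; lra.
apply: sumr_le0 => i /mem_rem ib; rewrite BZr.
have [->|iw] := eqVneq i w; first by move: pw; rewrite /p negbK => /eqP->; rewrite mul0r.
by rewrite mulr_ge0_le0 ?px // simple_B_le0 // eq_sym.
Qed.

(** Full support makes [B x y] positive. If it is 1, then [x - y] is a root; when it is positive,
    its pairing -1 with y contradicts dominance of y, and the other sign is symmetric. *)
Lemma dominant_uniq x y : x \in Phi -> dominant x -> pos x ->
  y \in Phi -> dominant y -> pos y -> x = y.
Proof.
move=> xP dx px yP dy py; have cx := dominant_pos xP dx px.
have xy0 : 0 < B x y.
  have ge0 : {in b, forall z, 0 <= B x (om z) * B z y}.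
    by move=> z zb; rewrite mulr_ge0 ?px ?dy.
  have e1 : B x y = \sum_(z <- b | z \in b) B x (om z) * B z y.
    rewrite [in LHS](b_expand x) B_suml [LHS]big_seq.
    by apply: eq_bigr => z _; rewrite BZl.
  rewrite e1 lt_neqAle sumr_ge0 ?andbT // eq_sym psumr_eq0 //.
  apply: contra (root_nz yP) => /allP y0; apply/eqP/B_simple_eq0 => z zb.
  by have := y0 z zb; rewrite zb mulf_eq0 gt_eqF ?cx //= => /eqP.
have [//|xe|[]xy] := root_B_cases xP yP; try (exfalso; lra).
  by exfalso; move: xy0; rewrite xe BNl Phi2 //; lra.
exfalso; have gP : x - y \in Phi by have := Phi_refl yP xP; rewrite /refl BC xy scale1r.
have [p|n] := root_pos gP.
  by have := pos_dominant p dy; rewrite BDl BNl xy Phi2 //; lra.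
by have := pos_dominant n dx; rewrite opprB BDl BNl (BC y x) xy Phi2 //; lra.
Qed.

Lemma highest_marks : b != [::] ->
  {in b, forall r, exists2 a, a \in Phi & 1 < B a (om r)} ->
  exists x (m : V -> nat), [/\ x \in Phi, dominant x &
    {in b, forall y, (1 < m y)%N /\ B x (om y) = (m y)%:R}].
Proof.
move=> bn0 nm.
have above r : r \in b -> exists x, [/\ x \in Phi, dominant x, pos x & 1 < B x (om r)].
  move=> rb; have [a aP a1] := nm r rb; have [pa|na] := root_pos aP; last first.
    by have := na r rb; rewrite BNl; lra.
  have [x [xP dx ax]] := root_dominant_above aP pa; exists x; split=> //.
    by move=> y yb; apply: le_trans (pa y yb) (ax y yb).
  exact: lt_le_trans a1 (ax r rb).
have [r rb] : exists r, r \in b by case: b bn0 => // r s _; exists r; rewrite mem_head.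
have [x [xP dx px _]] := above r rb.
exists x, (fun y => Num.trunc (B x (om y))); split=> // y yb.
have [n en] := coef_nat xP px yb; rewrite en truncnK ?natr_nat //; split=> //.
have [x' [x'P dx' px']] := above y yb.
rewrite (dominant_uniq x'P dx' px' xP dx px) en natrK -[1]/(1%:R) ltr_nat.
by [].
Qed.

(** * Diagrams without a minuscule node *)

Definition adj x y := B x y == -1.
Definition nbrs x := [seq y <- b | adj x y].

Lemma adjC x y : adj x y = adj y x. Proof. by rewrite /adj BC. Qed.

Lemma adjxx x : x \in b -> adj x x = false.
Proof. by move=> xb; rewrite /adj Phi2 ?b_root //; apply/eqP; lra. Qed.

Lemma mem_nbrs x y : (y \in nbrs x) = adj x y && (y \in b).
Proof. by rewrite mem_filter. Qed.

Lemma uniq_nbrs x : uniq (nbrs x). Proof. exact: filter_uniq. Qed.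

Lemma marks_sum (m : V -> nat) x y : {in b, forall z, B x (om z) = (m z)%:R} -> y \in b ->
  B y x = (2 * m y)%:R - (\sum_(z <- nbrs y) m z)%:R.
Proof.
move=> xm yb; rewrite (b_expand x) B_sumr (bigD1_seq y) //= BZr Phi2 ?b_root //.
rewrite xm // mulrC natrM; congr (_ + _).
rewrite big_filter raddf_sum /= -sumrN [LHS]big_seq_cond [RHS]big_seq_cond.
rewrite [LHS]big_mkcond [RHS]big_mkcond; apply: eq_bigr => z _ /=.
have [zb|//] := boolP (z \in b); rewrite /= BZr xm //.
have [->|zy] := eqVneq z y; first by rewrite adjxx.
have yz : y != z by rewrite eq_sym.
have [e0|e0] := simple_B yb zb yz; rewrite /adj e0.
  by rewrite mulr0 eq_sym oppr_eq0 oner_eq0.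
by rewrite eqxx mulrN1.
Qed.

(** In 2 = B x x, the sum of m_y B y x, all terms are nonnegative and the marks are at least 2. So a
    single simple root x1 pairs nontrivially with x, with pairing 1 and mark 2. The affine node, of
    mark 1, would be attached to x1 and raise its neighbour sum from 3 to 4. *)
Lemma affine_marks (m : V -> nat) x : x \in Phi -> dominant x ->
  {in b, forall y, (1 < m y)%N /\ B x (om y) = (m y)%:R} ->
  exists2 x1, x1 \in b & [/\ m x1 = 2, \sum_(z <- nbrs x1) m z = 3 &
    {in b, forall y, y != x1 -> \sum_(z <- nbrs y) m z = 2 * m y}]%N.
Proof.
move=> xP dx xm.
have xm' : {in b, forall z, B x (om z) = (m z)%:R} by move=> z /xm[].
have [/hasP[x1 x1b x1x]|/hasPn H] := boolP (has (fun y => B y x != 0) b); last first.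
  have := root_nz xP; case/eqP; apply: B_simple_eq0 => y /H.
  by rewrite negbK => /eqP.
have m1 y : y \in b -> 2 <= B x (om y) by move=> yb; rewrite xm' // ler_nat; have [] := xm y yb.
have e1 : B x1 x = 1.
  have [x1e|x1e|[//|/eqP|]] := root_B_cases (b_root x1b) xP.
  - by have := m1 x1 x1b; rewrite -x1e om_id //; lra.
  - by have := dx x1 x1b; rewrite x1e BNl Phi2 //; lra.
  - by rewrite (negPf x1x).
  - by have := dx x1 x1b; lra.
have sum2 : B x (om x1) + \sum_(y <- b | y != x1) B x (om y) * B y x = 2.
  have -> : 2 = B (\sum_(y <- b) B x (om y) *: y) x by rewrite -b_expand Phi2.
  rewrite B_suml [RHS](bigD1_seq x1) //= BZl e1 mulr1.
  by congr (_ + _); apply: eq_bigr => y _; rewrite BZl.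
have ge0 : {in b, forall y, 0 <= B x (om y) * B y x}.
  move=> y yb; rewrite mulr_ge0 ?dx //; apply: le_trans (m1 y yb); lra.
have s0 : 0 <= \sum_(y <- b | y != x1) B x (om y) * B y x.
  by rewrite big_seq_cond sumr_ge0 // => y /andP[yb _]; apply: ge0.
have ex1 : B x (om x1) = 2 by have := m1 x1 x1b; lra.
have {}s0 : {in b, forall y, y != x1 -> B y x = 0}.
  have : \sum_(y <- b | y != x1) B x (om y) * B y x == 0 by apply/eqP; lra.
  rewrite big_seq_cond psumr_eq0 => [/allP H y yb yx1|y /andP[yb _]]; last exact: ge0.
  have := H y yb; rewrite yb yx1 /= mulf_eq0 => /orP[|/eqP//].
  by move=> /eqP y0; have := m1 y yb; rewrite y0; lra.
exists x1 => //.
have mx1 : m x1 = 2%N by apply/eqP; rewrite -(eqr_nat R) -xm' // ex1.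
split=> //.
  have := marks_sum xm' x1b; rewrite e1 mx1 => e2; apply/eqP; rewrite -(eqr_nat R).
  by apply/eqP; lra.
move=> y yb yx1; have := marks_sum xm' yb; rewrite s0 // => e2.
by apply/eqP; rewrite -(eqr_nat R); apply/eqP; lra.
Qed.

(* In [chain (x :: C)] the only neighbour of [x] in [C] is the head of [C]. *)
Fixpoint chain s : bool := if s is x :: C then
  (if C is q :: _ then adj x q && all (fun z => (z == q) || ~~ adj x z) C else true)
  && chain C else true.

Section E8.
Variables (m : V -> nat) (x1 : V).
Hypothesis x1b : x1 \in b.
Hypothesis m_gt1 : {in b, forall y, 1 < m y}%N.
Hypothesis m_x1 : m x1 = 2%N.
Hypothesis sum_x1 : (\sum_(z <- nbrs x1) m z = 3)%N.
Hypothesis sum_nbrs : {in b, forall y, y != x1 -> \sum_(z <- nbrs y) m z = 2 * m y}%N.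

Lemma sum_rem y z : y \in b -> y != x1 -> z \in nbrs y ->
  (m z + \sum_(w <- rem z (nbrs y)) m w = 2 * m y)%N.
Proof. by move=> yb yx1 zy; rewrite -(sum_nbrs yb yx1) [RHS](big_rem z zy). Qed.

Lemma rem_sub s z w : {subset s <= b} -> w \in rem z s -> w \in b.
Proof. by move=> sb /mem_rem/sb. Qed.

Lemma sum_le1 s : {subset s <= b} -> (\sum_(w <- s) m w <= 1)%N -> s = [::].
Proof.
case: s => // y s sb; rewrite big_cons.
by have := m_gt1 (sb y (mem_head _ _)); clear; lia.
Qed.

Lemma sum_le3 s : {subset s <= b} -> (1 < \sum_(w <- s) m w <= 3)%N ->
  exists2 y, s = [:: y] & m y = (\sum_(w <- s) m w)%N.
Proof.
case: s => [|y [|z s]] sb; rewrite ?big_nil // !big_cons ?big_nil.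
  by move=> _; exists y => //; rewrite addn0.
have := m_gt1 (sb y (mem_head _ _)).
have : (1 < m z)%N by apply/m_gt1/sb; rewrite !inE eqxx orbT.
by clear; lia.
Qed.

(* [x :: q :: C] is the arm of the diagram that starts at [x1], the neighbour of the
   affine node, read backwards; along it the marks are 2, 3, 4, ... *)
Definition arm q C x :=
  [/\ uniq [:: x, q & C], {subset [:: x, q & C] <= b}, chain [:: x, q & C] & last q C = x1] /\
  [/\ {in q :: C, forall z, {in b, forall y, adj z y -> y \in [:: x, q & C]}},
      m x = size C + 3 & m q = size C + 2]%N.

(** Let n = size C. The neighbours of x other than q have mark sum 2(n+3) - (n+2) = n+4, and a
    single one extends the arm. For two, with m u <= m w, the sum left beyond u is 2 m u - (n+3) <=
    1, so u is a leaf and 2 m u = n+3. Then 2 beyond w is left for one node w' of mark 2. As m u >=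
    2 gives m w >= 3, at most 4 - 3 is left beyond w', so w' is a leaf too, m w = 4 and n = 3. *)
Lemma arm_step q C x : arm q C x ->
  (exists y, arm x (q :: C) y) \/
  size C = 3%N /\ exists u w w', [/\ perm_eq (nbrs x) [:: q; u; w],
    perm_eq (nbrs u) [:: x], perm_eq (nbrs w) [:: x; w'] & perm_eq (nbrs w') [:: w]].
Proof.
move=> [[uC sC cC lC] [clC mx mq]].
have xb : x \in b by apply/sC/mem_head.
have qb : q \in b by apply: sC; rewrite !inE eqxx orbT.
have [xC uC'] : x \notin q :: C /\ uniq (q :: C) by move: uC => /= /andP[].
have x1C : x1 \in q :: C by rewrite -lC mem_last.
have xx1 : x != x1 by apply: contraNneq xC => ->.
have [xq xN] : adj x q /\ {in q :: C, forall z, adj x z -> z = q}.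
  move: cC; rewrite -[chain _]/(adj x q && all (fun z => (z == q) || ~~ adj x z) (q :: C) && chain (q :: C)).
  move=> /andP[/andP[xq /allP H] _]; split=> // z /H.
  by case/orP=> [/eqP//|/negPf->].
have qN : q \in nbrs x by rewrite mem_nbrs xq.
have := perm_to_rem qN; have := sum_rem xb xx1 qN; have := uniq_nbrs x.
have : {in rem q (nbrs x), forall u, [/\ u \in b, adj x u, u \notin q :: C & u != x] /\
    [/\ u != x1, x \in nbrs u & (m x <= 2 * m u)%N]}.
  move=> u uN; have /and3P[uq xu ub] : [&& u != q, adj x u & u \in b].
    by rewrite -mem_nbrs; move: uN; rewrite (mem_rem_uniq _ (uniq_nbrs x)).
  have uC0 : u \notin q :: C by apply: contra uq => /xN->.
  have ux : u != x by apply: contraTneq xu => ->; rewrite adjxx.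
  have ux1 : u != x1 by apply: contraNneq uC0 => ->.
  have xu' : x \in nbrs u by rewrite mem_nbrs adjC xu.
  by split; split=> //; rewrite -(sum_rem ub ux1 xu') leq_addr.
move: (rem q (nbrs x)) => rs rsP uN srs pN.
have sum_rs : (\sum_(w <- rs) m w = size C + 4)%N.
  by move: srs; rewrite mx mq; move: (\sum_(z <- rs) m z)%N; clear; lia.
case: rs => [|u [|w rs]] in rsP srs pN sum_rs *.
- by move: sum_rs; rewrite big_nil addnS.
- left; exists u; have [[ub xu uC0 ux] [ux1 _ _]] := rsP u (mem_head _ _).
  split; split.
  + by rewrite /= -/(uniq [:: x, q & C]) uC andbT inE negb_or ux.
  + by move=> z; rewrite inE => /predU1P[->|/sC].
  + rewrite -[chain _]/(adj u x && all (fun z => (z == x) || ~~ adj u z) [:: x, q & C] && chain [:: x, q & C]).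
    rewrite cC adjC xu andbT; apply/allP => z.
    rewrite inE => /predU1P[->|zC]; first by rewrite eqxx.
    apply/orP; right; apply: contra uC0; rewrite adjC => zu.
    by have := clC z zC u ub zu; rewrite inE (negPf ux).
  + exact: lC.
  + move=> z; rewrite inE => /predU1P[->|zC] y yb zy; last first.
      by rewrite inE (clC z zC y yb zy) orbT.
    have : y \in nbrs x by rewrite mem_nbrs zy.
    by rewrite (perm_mem pN) !inE => /orP[/eqP->|/eqP->]; rewrite eqxx ?orbT.
  + by move: sum_rs; rewrite big_seq1 /= => ->; rewrite addSnnS.
  + by rewrite mx /= addSnnS.
(* Each further neighbour has at least half the mark of x, so three of them exceed the sum size C +
   4. *)
right; case: rs => [|w' rs] in rsP srs pN sum_rs *; last first.
  have [_ [_ _ m1]] := rsP u (mem_head _ _).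
  have [|_ [_ _ m2]] := rsP w; first by rewrite !inE eqxx orbT.
  have [|_ [_ _ m3]] := rsP w'; first by rewrite !inE eqxx !orbT.
  by move: sum_rs m1 m2 m3; rewrite !big_cons mx; move: (\sum_(z <- rs) m z)%N; clear; lia.
wlog uw : u w rsP srs pN sum_rs / (m u <= m w)%N => [H|].
  have [uw|/ltnW wu] := leqP (m u) (m w); first exact: (H u w).
  apply: (H w u) => //.
  - by move=> z zs; apply: rsP; move: zs; rewrite !inE orbC.
  - by move: srs; rewrite !big_cons (addnCA (m u)).
  - by apply: perm_trans pN _; rewrite perm_cons (perm_catC [:: u] [:: w]).
  - by move: sum_rs; rewrite !big_cons (addnCA (m u)).
have [[ub xu uC0 ux] [ux1 uNx um]] := rsP u (mem_head _ _).
have [|[wb xw wC0 wx] [wx1 wNx wm]] := rsP w; first by rewrite !inE eqxx orbT.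
have muw : (m u + m w = size C + 4)%N by move: sum_rs; rewrite !big_cons big_nil addn0.
have su := sum_rem ub ux1 uNx; have sw := sum_rem wb wx1 wNx.
have Nb y : {subset nbrs y <= b} by move=> z; rewrite mem_nbrs => /andP[].
have ru : rem x (nbrs u) = [::].
  apply: sum_le1 => [z|]; first by apply: rem_sub; apply: Nb.
  by move: su muw uw; rewrite mx; move: (\sum_(z <- rem x (nbrs u)) m z)%N; clear; lia.
have pu := perm_to_rem uNx; rewrite ru in pu.
rewrite ru big_nil in su.
have [||w' rw mw'] := @sum_le3 (rem x (nbrs w)); first by move=> z; apply: rem_sub; apply: Nb.
  by move: su sw muw; rewrite mx; move: (\sum_(z <- rem x (nbrs w)) m z)%N; clear; lia.
have pw := perm_to_rem wNx; rewrite rw in pw.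
have w'N : w' \in nbrs w by rewrite (perm_mem pw) !inE eqxx orbT.
have [ww' w'b] : adj w w' /\ w' \in b by move: w'N; rewrite mem_nbrs => /andP[].
have w'x1 : w' != x1.
  apply/eqP => e1; have := clC x1 x1C w wb; rewrite -e1 adjC ww' inE (negPf wx).
  by move=> /(_ isT); apply/negP.
have wN' : w \in nbrs w' by rewrite mem_nbrs adjC ww'.
have sw' := sum_rem w'b w'x1 wN'.
have rw' : rem w (nbrs w') = [::].
  apply: sum_le1 => [z|]; first by apply: rem_sub; apply: Nb.
  move: su sw sw' muw mw'; rewrite mx.
  move: (\sum_(z <- rem x (nbrs w)) m z)%N (\sum_(z <- rem w (nbrs w')) m z)%N.
  by clear; lia.
have pw' := perm_to_rem wN'; rewrite rw' big_nil in pw' sw'.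
split; last by exists u, w, w'.
by move: su sw sw' muw mw'; rewrite mx; move: (\sum_(z <- rem x (nbrs w)) m z)%N; clear; lia.
Qed.

Lemma arm_start : exists x2, arm x1 [::] x2.
Proof.
have [||x2 e2 m2] := @sum_le3 (nbrs x1); rewrite ?sum_x1 //.
  by move=> z; rewrite mem_nbrs => /andP[].
have : x2 \in nbrs x1 by rewrite e2 mem_head.
rewrite mem_nbrs => /andP[x12 x2b]; exists x2.
have x21 : x2 != x1 by apply: contraTneq x12 => ->; rewrite adjxx.
split; split=> //=.
- by rewrite inE x21.
- by move=> z; rewrite !inE => /orP[|] /eqP->.
- by rewrite adjC x12 eqxx.
- move=> z; rewrite inE => /eqP-> y yb zy.
  have : y \in nbrs x1 by rewrite mem_nbrs zy.
  by rewrite e2 !inE => ->.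
- by rewrite m2 sum_x1.
Qed.

(** The arm cannot grow forever: its marks increase and are bounded by the sum of all marks. *)
Lemma arm_end q C x : arm q C x -> exists q' C' x' u w w',
  [/\ arm q' C' x', size C' = 3%N, perm_eq (nbrs x') [:: q'; u; w],
      perm_eq (nbrs u) [:: x'] &
      perm_eq (nbrs w) [:: x'; w'] /\ perm_eq (nbrs w') [:: w]].
Proof.
have [n] := ubnP ((\sum_(y <- b) m y) - size C)%N.
elim: n q C x => // n IH q C x lt_n a.
have [[y a']|[s3 [u [w [w' [? ? ? ?]]]]]] := arm_step a; last first.
  by exists q, C, x, u, w, w'.
apply: IH a'; have [[_ sC _ _] [_ mx _]] := a.
have xb : x \in b by apply/sC/mem_head.
have : (m x <= \sum_(y <- b) m y)%N by rewrite (big_rem x) //= leq_addr.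
by move: lt_n; rewrite mx /=; move: (\sum_(z <- b) m z)%N; clear; lia.
Qed.

(** Nodes 0 to 4 lead from the neighbour of the affine node to the branching node, 5 is the leaf
    there, and 6, 7 form the third arm; the marks are 2, 3, 4, 5, 6, 3, 4, 2. *)
Definition E8_nbrs (i : nat) : seq nat := nth [::]
  [:: [:: 1]; [:: 0; 2]; [:: 1; 3]; [:: 2; 4]; [:: 3; 5; 6]; [:: 4]; [:: 4; 7]; [:: 6]]%N i.

Lemma E8_nbrs_sym i j : (i < 8)%N -> (j < 8)%N ->
  (j \in E8_nbrs i) = (i \in E8_nbrs j).
Proof.
by case: i => [|[|[|[|[|[|[|[|i]]]]]]]]; case: j => [|[|[|[|[|[|[|[|j]]]]]]]].
Qed.

Lemma E8_diagram : exists Y : seq V, [/\ size Y = 8%N, perm_eq Y b &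
  forall i j, (i < 8)%N -> (j < 8)%N -> i != j ->
    B Y`_i Y`_j = - (j \in E8_nbrs i)%:R].
Proof.
have [x2 /arm_end[q [C [x [u [w [w' [a sC pN pu [pw pw']]]]]]]]] := arm_start.
case: C a sC => [|x3 [|x2' [|x1' []]]] // [[uC sC + lC] [clC _ _]] _.
rewrite /= !andbT /= in lC *; move: lC clC uC sC pN => {x1'}->.
move: x2' => {}x2 clC uC sC pN /=; rewrite !eqxx /=.
case/andP=> /and4P[xq Nx3 Nx2 Nx1]; case/andP=> /and3P[qx3 Nq2 Nq1].
case/andP=> /andP[x32 N31]; rewrite andbT => x21.
have nN z y : y \in b -> adj z y = (y \in nbrs z) by rewrite mem_nbrs => ->; rewrite andbT.
have Nb z y : y \in nbrs z -> y \in b by rewrite mem_nbrs => /andP[].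
have ub : u \in b by apply: (Nb x); rewrite (perm_mem pN) !inE eqxx orbT.
have wb : w \in b by apply: (Nb x); rewrite (perm_mem pN) !inE eqxx !orbT.
have w'b : w' \in b by apply: (Nb w); rewrite (perm_mem pw) !inE eqxx !orbT.
have xb : x \in b by apply/sC/mem_head.
have [xu xw] : adj x u /\ adj x w by rewrite !nN // !(perm_mem pN) !inE !eqxx !orbT.
have ww' : adj w w' by rewrite nN // (perm_mem pw) !inE eqxx orbT.
have : uniq [:: q; u; w] by rewrite -(perm_uniq pN) uniq_nbrs.
rewrite /= !inE !negb_or !andbT => /andP[/andP[qu qw] uw].
have : uniq [:: x; w'] by rewrite -(perm_uniq pw) uniq_nbrs.
rewrite /= !inE !andbT => xw'.
move: (uC); rewrite /= !inE !negb_or !andbT => /and4P[].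
case/and4P=> xq' xx3 xx2 xx1 /and3P[qx3' qx2 qx1] /andP[x32' x31] x21'.
rewrite eq_sym (negPf qx3') /= in Nx3.
rewrite eq_sym (negPf qx2) /= in Nx2.
rewrite eq_sym (negPf qx1) /= in Nx1.
rewrite eq_sym (negPf x32') /= in Nq2.
rewrite eq_sym (negPf x31) /= in Nq1.
rewrite eq_sym (negPf x21') /= in N31.
have out y : adj x y -> y != q -> y \notin [:: x; q; x3; x2; x1].
  move=> xy yq; apply/negP; rewrite !inE (negPf yq) => /or4P[|||/orP[|]] /eqP ye //; subst y.
  - by rewrite adjxx in xy.
  - by rewrite xy in Nx3.
  - by rewrite xy in Nx2.
  - by rewrite xy in Nx1.
have uC5 : u \notin [:: x; q; x3; x2; x1] by rewrite out // eq_sym.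
have wC5 : w \notin [:: x; q; x3; x2; x1] by rewrite out // eq_sym.
have w'C5 : w' \notin [:: x; q; x3; x2; x1].
  rewrite inE eq_sym negb_or xw'; apply: contra wC5 => w'C.
  by apply: (clC _ w'C w wb); rewrite adjC.
have uw' : u != w'.
  apply: contraTneq ww' => <-; rewrite adjC nN // (perm_mem pu) inE.
  by apply: contraNneq wC5 => ->; rewrite mem_head.
have w'w : w' != w by apply: contraTneq ww' => ->; rewrite adjxx.
pose Y := [:: x1; x2; x3; q; x; u; w; w'].
have uY : uniq Y.
  have -> : uniq Y = uniq (rev [:: x; q; x3; x2; x1] ++ [:: u; w; w']) by [].
  rewrite cat_uniq rev_uniq uC; apply/and3P; split=> //.
    apply/hasPn => z zs.
    suff : z \notin [:: x; q; x3; x2; x1] by rewrite -mem_rev.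
    by move: zs; rewrite 3!inE => /or3P[] /eqP->.
  by rewrite /= !inE !negb_or uw uw' eq_sym w'w.
have sY : {subset Y <= b}.
  move=> z; have -> : (z \in Y) = (z \in rev [:: x; q; x3; x2; x1] ++ [:: u; w; w']) by [].
  by rewrite mem_cat mem_rev => /orP[/sC//|]; rewrite !inE => /or3P[] /eqP->.
have cl z y : z \in [:: q; x3; x2; x1] -> y \in b -> y \notin [:: x; q; x3; x2; x1] -> adj z y = false.
  by move=> zC yb; apply: contraNF => /(clC z zC y yb).
have adjE i j : (i < j < 8)%N -> adj Y`_i Y`_j = (j \in E8_nbrs i).
  have xw'N : adj x w' = false.
    by rewrite nN // (perm_mem pN) inE eq_sym; move: w'C5; rewrite !inE !negb_or => /and3P[_ /negPf w'q _];
      rewrite eq_sym w'q (eq_sym _ u) (negPf uw') (negPf w'w).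
  have uN y : y \in b -> y != x -> adj u y = false.
    by move=> yb yx; rewrite nN // (perm_mem pu) inE (negPf yx).
  have [wx w'x] : w != x /\ w' != x.
    by split; [apply: contraNneq wC5|apply: contraNneq w'C5] => ->; rewrite mem_head.
  have mC : [/\ q \in [:: q; x3; x2; x1], x3 \in [:: q; x3; x2; x1],
    x2 \in [:: q; x3; x2; x1] & x1 \in [:: q; x3; x2; x1]].
    by rewrite !inE !eqxx !orbT.
  case: mC => qC x3C x2C x1C.
  case/andP; case: i => [|[|[|[|[|[|[|[|i]]]]]]]]; case: j => [|[|[|[|[|[|[|[|j]]]]]]]] //= _ _;
    rewrite ?inE /=;
    first [ by rewrite cl | by rewrite uN | exact: xw'N | by rewrite adjC; apply/negbTE
          | by rewrite adjC | by [] ].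
exists Y; split=> //.
  apply: uniq_perm => // z; apply/idP/idP => [/sY//|zb]; apply: contraT => zY.
  (* Y is closed under adjacency, so connectedness leaves no simple root outside it. *)
  have [||y [y' [yb y'b yY y'Y /eqP yy']]] := @simple_connected (mem Y).
  - by apply/hasP; exists x1; [exact: x1b | exact: mem_head].
  - by apply/hasP; exists z; [exact: zb | exact: zY].
  case/negP: y'Y; rewrite -/(adj y y') in yy'.
  have mY : (y' \in Y) = (y' \in rev [:: x; q; x3; x2; x1] ++ [:: u; w; w']) by [].
  rewrite /= mY mem_cat mem_rev.
  have : y \in [:: q; x3; x2; x1] ++ [:: x; u; w; w'].
    by move: yY; rewrite /= !inE => /or4P[|||/or4P[||| /orP[|]]] /eqP->; rewrite !eqxx ?orbT.
  rewrite mem_cat => /orP[yC|]; first by rewrite (clC y yC y' y'b yy').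
  move: yy'; rewrite nN // !inE => yy' /or4P[] /eqP ye; move: yy'; rewrite ye.
  - by rewrite (perm_mem pN) !inE => /or3P[] /eqP->; rewrite eqxx ?orbT.
  - by rewrite (perm_mem pu) !inE => /eqP->; rewrite eqxx.
  - by rewrite (perm_mem pw) !inE => /orP[] /eqP->; rewrite eqxx ?orbT.
  - by rewrite (perm_mem pw') !inE => /eqP->; rewrite eqxx ?orbT.
move=> i j i8 j8 ij.
have -> : (j \in E8_nbrs i) = adj Y`_i Y`_j.
  case: (ltngtP i j) ij => // lt _; first by rewrite adjE ?lt.
  rewrite adjC adjE ?lt //.
  exact: E8_nbrs_sym.
have yij : Y`_i != Y`_j by rewrite nth_uniq.
have yi : Y`_i \in b by apply/sY/mem_nth.
have yj : Y`_j \in b by apply/sY/mem_nth.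
have [e0|e0] := simple_B yi yj yij; rewrite /adj e0.
  by rewrite eq_sym oppr_eq0 oner_eq0 oppr0.
by rewrite eqxx.
Qed.
End E8.

(** * Type E8 *)

(* A root is represented by its coefficients on [Y], whose diagram is [E8_nbrs]. *)
Definition E8_refl (i : nat) (n : seq int) : seq int :=
  set_nth 0 n i (foldr (fun j k => n`_j + k) (- n`_i) (E8_nbrs i)).
Definition E8_word (s : seq nat) (n : seq int) : seq int := foldr E8_refl n s.
Definition E8_cox := E8_word (iota 0 8).
Definition E8_theta (i : nat) := E8_word (iota 0 i) (set_nth 0 (nseq 8 0) i 1).
Definition E8_orbit (i k : nat) := iter k E8_cox (E8_theta i).
(** Twice the pairing with [E8_vertex], kept integral for evaluation; the facet is where it equals
    2. *)
Definition E8_pair (n : seq int) : int := n`_1 - 2 * n`_5 + n`_6.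

(** 30 is the Coxeter number of E8. Here it is the period of eight explicit orbits, which makes the
    table of roots finite. *)
Lemma E8_period i : (i < 8)%N -> iter 30 E8_cox (E8_theta i) = E8_theta i.
Proof. by do 8?[case: i => [|i]]; rewrite // => _; vm_compute. Qed.

Lemma E8_orbit_mod i k : (i < 8)%N -> E8_orbit i (k %% 30) = E8_orbit i k.
Proof.
by move=> i8; rewrite /E8_orbit [RHS](iter_modn _ (E8_period i8)).
Qed.

Lemma E8_pair_le2 i k : (i < 8)%N -> (k < 30)%N -> E8_pair (E8_orbit i k) <= 2.
Proof.
have : all (fun i => all (fun k => E8_pair (E8_orbit i k) <= 2) (iota 0 30)) (iota 0 8).
  by vm_compute.
move=> /allP H i8 k30; have := H i; rewrite mem_iota => /(_ i8)/allP/(_ k).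
by rewrite mem_iota; apply.
Qed.

(* Found by computer search over the 2160 vertices of this type: with [E8_vertex]
   below, the root c^(E8_hit i) theta_i lies on the facet of that vertex. *)
Definition E8_hit i := nth 0%N [:: 6; 5; 4; 3; 2; 1; 0; 0]%N i.

Lemma E8_pair_hit i : (i < 8)%N -> E8_pair (E8_orbit i (E8_hit i)) = 2.
Proof. by do 8?[case: i => [|i]]; rewrite // => _; vm_compute. Qed.

Section E8Cover.
Variable Y : seq V.
Hypothesis Y8 : size Y = 8%N.
Hypothesis Yb : perm_eq Y b.
Hypothesis YB : forall i j, (i < 8)%N -> (j < 8)%N -> i != j ->
  B Y`_i Y`_j = - (j \in E8_nbrs i)%:R.

Lemma Y_in i : (i < 8)%N -> Y`_i \in b.
Proof. by move=> i8; rewrite -(perm_mem Yb) mem_nth ?Y8. Qed.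

Lemma Y_eq i j : (i < 8)%N -> (j < 8)%N -> (Y`_i == Y`_j) = (i == j).
Proof. by move=> i8 j8; rewrite nth_uniq ?Y8 // (perm_uniq Yb). Qed.

Definition comb (n : seq int) : V := \sum_(i < 8) (n`_i)%:~R *: Y`_i.

Lemma comb_set n i k : (i < 8)%N ->
  comb (set_nth 0 n i k) = comb n + (k - n`_i)%:~R *: Y`_i.
Proof.
move=> i8; rewrite /comb (bigD1 (Ordinal i8)) //= [in RHS](bigD1 (Ordinal i8)) //=.
rewrite nth_set_nth /= eqxx.
have -> : k%:~R *: Y`_i = (n`_i)%:~R *: Y`_i + (k - n`_i)%:~R *: Y`_i.
  by rewrite -scalerDl -rmorphD /= addrC subrK.
rewrite [RHS]addrAC; congr (_ + _).
apply: eq_bigr => j; rewrite -val_eqE /= => ji.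
by rewrite nth_set_nth /= (negPf ji).
Qed.

Lemma B_comb n i : (i < 8)%N -> B Y`_i (comb n) =
  (n`_i - foldr (fun j k => n`_j + k) (- n`_i) (E8_nbrs i))%:~R.
Proof.
move=> i8; rewrite /comb B_sumr.
pose g j : R := if i == j then 2 else - (j \in E8_nbrs i)%:R.
transitivity (\sum_(j < 8) (n`_j)%:~R * g j).
  apply: eq_bigr => j _; rewrite BZr /g; case: eqVneq => [<-|ij].
    by rewrite Phi2 // b_root // Y_in.
  by rewrite YB.
rewrite !big_ord_recl big_ord0 /g /= /bump !add1n /=.
by case: i i8 {g} => [|[|[|[|[|[|[|[|i]]]]]]]] //= _;
  rewrite ?(rmorphD, rmorphN) /=; ring.
Qed.

Lemma refl_comb n i : (i < 8)%N -> refl Y`_i (comb n) = comb (E8_refl i n).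
Proof.
move=> i8; rewrite /refl B_comb // comb_set // -scaleNr -rmorphN opprB.
by [].
Qed.

Lemma refls_comb (s : seq nat) n : all (fun i => i < 8)%N s ->
  map (nth 0 Y) s @@ comb n = comb (E8_word s n).
Proof. by elim: s => //= i s IH /andP[i8 /IH->]; rewrite refl_comb. Qed.

Lemma Y_iota : Y = map (nth 0 Y) (iota 0 8).
Proof. by rewrite -Y8 map_nth_iota0 // take_size. Qed.

Lemma cox_comb k n : iter k (cox Y) (comb n) = comb (iter k E8_cox n).
Proof.
elim: k => // k IH; rewrite !iterS IH; move: (iter _ _ _) => n'.
by rewrite /E8_cox -refls_comb // -Y_iota.
Qed.

Lemma comb_simple i : (i < 8)%N -> comb (set_nth 0 (nseq 8 0) i 1) = Y`_i.
Proof.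
move=> i8; rewrite comb_set // nth_nseq i8 subr0 scale1r /comb big1 ?add0r // => j _.
by rewrite nth_nseq ltn_ord scale0r.
Qed.

Lemma Y_split t1 y t2 : Y = t1 ++ y :: t2 ->
  exists2 i, (i < 8)%N & t1 @@ y = comb (E8_theta i).
Proof.
move=> eY; exists (size t1); first by rewrite -Y8 eY size_cat /= addnS ltnS leq_addr.
have i8 : (size t1 < 8)%N by rewrite -Y8 eY size_cat /= addnS ltnS leq_addr.
rewrite -refls_comb; last first.
  by apply/allP => j; rewrite mem_iota /= add0n => ji; apply: ltn_trans i8.
rewrite comb_simple // eY nth_cat ltnn subnn /=; congr (foldr _ _ _).
rewrite -[in LHS](take_size_cat (y :: t2) (erefl (size t1))).
by rewrite map_nth_iota0 // size_cat leq_addr.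
Qed.

Definition E8_vertex : V := 2^-1 *: (om Y`_1 - 2 *: om Y`_5 + om Y`_6).

Lemma B_vertex n : B (comb n) E8_vertex = 2^-1 * (E8_pair n)%:~R.
Proof.
rewrite BZr; congr (_ * _); rewrite BDr BDr BNr BZr /comb !B_suml.
rewrite !big_ord_recl !big_ord0 /= /bump !add1n /= !BZl !om_dual ?Y_in // !Y_eq //= /E8_pair.
by rewrite !rmorphD rmorphN rmorphM /=; ring.
Qed.

Lemma E8_growing : growing Y`_0 Y.
Proof.
have step k : (0 < k < 8)%N -> growing Y`_0 [seq Y`_i | i <- iota 0 k] ->
    growing Y`_0 [seq Y`_i | i <- iota 0 k.+1].
  move=> /andP[k0 k8] gk; rewrite -addn1 iotaD map_cat /= add0n cats1.
  apply: growing_rcons => //; first exact: Y_in.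
    apply/mapP => -[j]; rewrite mem_iota add0n /= => jk /eqP.
    by rewrite Y_eq // ?(ltn_trans jk) // gtn_eqF.
  rewrite big_map B_suml big_seq.
  transitivity (\sum_(i <- iota 0 k) - (k \in E8_nbrs i)%:R : R).
    rewrite [RHS]big_seq; apply: eq_bigr => j; rewrite mem_iota add0n /= => jk.
    by rewrite YB ?(ltn_trans jk) // ltn_eqF.
  by case: k k0 k8 {gk} => [|[|[|[|[|[|[|[|k]]]]]]]] //= _ _; rewrite !big_cons big_nil /=; ring.
have g k : (k < 8)%N -> growing Y`_0 [seq Y`_i | i <- iota 0 k.+1].
  elim: k => [_|k IH k8]; first exact: growing1.
  by apply: step; [rewrite k8|apply/IH/ltnW].
by rewrite Y_iota; apply: g.
Qed.

Variable h : nat.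
Hypothesis Yh : has_order (cox Y) h.

Lemma E8_root a : a \in Phi -> exists i k, (i < 8)%N /\ iter k (cox Y) a = comb (E8_theta i).
Proof.
move=> aP; have [k [t1 [y [t2 [eY ek]]]]] := orbit_split Yb Yh aP.
by have [i i8 ei] := Y_split eY; exists i, k; rewrite ek.
Qed.

Lemma theta_root i k : (i < 8)%N -> comb (E8_orbit i k) \in Phi.
Proof.
move=> i8; rewrite -cox_comb; apply: (iter_root Yb).
rewrite -refls_comb ?comb_simple //; last first.
  by apply/allP => j; rewrite mem_iota add0n => /ltn_trans; apply.
apply: refls_root; last exact/b_root/Y_in.
move=> z /mapP[j]; rewrite mem_iota add0n => /= ji ->.
exact/b_root/Y_in/(ltn_trans ji).
Qed.

Lemma E8_cover :
  [/\ {in Phi, forall a, B a E8_vertex <= 1},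
      {in Phi, forall a, exists k, B (iter k (cox Y) a) E8_vertex = 1} &
      forall x, {in Phi, forall a, B a E8_vertex = 1 -> B a x = 0} -> x = 0].
Proof.
have half : 2^-1 * (2 : int)%:~R = 1 :> R.
  by rewrite -[(2 : int)%:~R]/(2 : R) mulVf ?pnatr_eq0.
split.
- move=> a aP; have [i [k [i8 ek]]] := E8_root aP.
  (* The inverse power c^(-k) is written as c^((h-1)k), then reduced modulo 30 to land in the
     table. *)
  have -> : a = comb (E8_orbit i ((h.-1 * k) %% 30)).
    rewrite E8_orbit_mod // /E8_orbit -cox_comb -ek -iterD -mulSnr prednK ?(h_gt0 Yh) //.
    by rewrite (iter_h Yh).
  rewrite B_vertex; have := E8_pair_le2 i8 (ltn_pmod (h.-1 * k) (isT : (0 < 30)%N)).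
  by rewrite -(ler_int R); lra.
- move=> a aP; have [i [k [i8 ek]]] := E8_root aP.
  exists (E8_hit i + k)%N; rewrite iterD ek cox_comb -/(E8_orbit _ _) B_vertex.
  by rewrite E8_pair_hit.
move=> x Hx.
have H i k n : (i < 8)%N -> (E8_orbit i k == n) && (E8_pair n == 2) ->
    \sum_(j < 8) (n`_j)%:~R * B Y`_j x = 0.
  move=> i8 /andP[/eqP <- /eqP e2]; have := Hx _ (theta_root k i8).
  rewrite B_vertex e2 half => /(_ erefl); rewrite /comb B_suml => e0.
  by rewrite -[RHS]e0; apply: eq_bigr => j _; rewrite BZl.
(* Eight independent roots of the facet, each located as c^k theta_i. The first four show that x is
   orthogonal to Y_5, Y_4, Y_3, Y_2 in turn; the next three give Y_1 + Y_6, Y_7 and Y_0, and the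
   last one Y_6. *)
have := H 5%N 29%N [:: 0; 0; 0; 0; 0; -1; 0; 0] isT ltac:(by vm_compute);
  rewrite !big_ord_recl big_ord0 /= /bump !add1n /= => H5_29.
have := H 7%N 27%N [:: 0; 0; 0; 0; -1; -1; 0; 0] isT ltac:(by vm_compute);
  rewrite !big_ord_recl big_ord0 /= /bump !add1n /= => H7_27.
have := H 0%N 27%N [:: 0; 0; 0; -1; -1; -1; 0; 0] isT ltac:(by vm_compute);
  rewrite !big_ord_recl big_ord0 /= /bump !add1n /= => H0_27.
have := H 0%N 22%N [:: 0; 0; -1; -1; -1; -1; 0; 0] isT ltac:(by vm_compute);
  rewrite !big_ord_recl big_ord0 /= /bump !add1n /= => H0_22.
have := H 5%N 1%N [:: 0; 1; 1; 1; 1; 0; 1; 0] isT ltac:(by vm_compute);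
  rewrite !big_ord_recl big_ord0 /= /bump !add1n /= => H5_1.
have := H 0%N 6%N [:: 0; 1; 1; 1; 1; 0; 1; 1] isT ltac:(by vm_compute);
  rewrite !big_ord_recl big_ord0 /= /bump !add1n /= => H0_6.
have := H 6%N 0%N [:: 1; 1; 1; 1; 1; 0; 1; 0] isT ltac:(by vm_compute);
  rewrite !big_ord_recl big_ord0 /= /bump !add1n /= => H6_0.
have := H 4%N 27%N [:: 0; 0; -1; -2; -3; -2; -2; -1] isT ltac:(by vm_compute);
  rewrite !big_ord_recl big_ord0 /= /bump !add1n /= => H4_27.
apply: B_simple_eq0 => y; rewrite -(perm_mem Yb) Y_iota => /mapP[i].
rewrite mem_iota /= => i8 ->.
by case: i i8 => [|[|[|[|[|[|[|[|i]]]]]]]] // _; lra.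
Qed.
End E8Cover.

(** * The covering orbit in all types *)

Lemma good_vertex h : b != [::] -> has_order (cox b) h -> exists e v,
  [/\ perm_eq e b, has_order (cox e) h, {in Phi, forall a, B a v <= 1},
      {in Phi, forall a, exists k, B (iter k (cox e) a) v = 1} &
      forall x, {in Phi, forall a, B a v = 1 -> B a x = 0} -> x = 0].
Proof.
move=> bn0 bh.
have [[r rb le1]|nmin] := pselect (exists2 r, r \in b & {in Phi, forall a, B a (om r) <= 1}).
  have [e ge eb] := growing_full rb.
  have eh : has_order (cox e) h by apply: (growing_order rb ge) bh; rewrite perm_sym.
  have [cov span] := minuscule_cover rb ge eb eh le1.
  by exists e, (om r).
have [|x [m [xP dx xm]]] := highest_marks bn0.
  move=> r rb; apply: contrapT => H; apply: nmin; exists r => // a aP.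
  by rewrite leNgt; apply/negP => lt; apply: H; exists a.
have [x1 x1b [m1 s1 sN]] := affine_marks xP dx xm.
have m_gt1 : {in b, forall y, 1 < m y}%N by move=> y /xm[].
have [Y [Y8 Yb YB]] := E8_diagram x1b m_gt1 m1 s1 sN.
have Yh : has_order (cox Y) h.
  have Y0 : Y`_0 \in b by apply: Y_in.
  by apply: (growing_order Y0 (E8_growing Y8 Yb YB)) bh; rewrite perm_sym.
have [le1 cov span] := E8_cover Y8 Yb YB Yh.
by exists Y, (E8_vertex Y).
Qed.

Lemma covering_seq h : b != [::] -> has_order (cox b) h -> exists S : seq V,
  [/\ size S = h, uniq S,
      {in S, forall x, {in Phi, forall a, B a x <= 1} /\
        (forall u, {in Phi, forall a, B a x = 1 -> B a u = 0} -> u = 0)} &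
      {in Phi, forall a, exists2 x, x \in S & B a x = 1}].
Proof.
move=> bn0 bh; have [e [v [eb eh le1 cov span]]] := good_vertex bn0 bh.
have [uS covS] := orbit_cover eb eh cov.
exists [seq iter j (cox e) v | j <- iota 0 h]; split=> //.
  by rewrite size_map size_iota.
move=> _ /mapP[j _ ->]; rewrite iter_cox; set w := flatten _.
have wP : {subset w <= Phi} by apply/sub_root/sub_word/e_sub.
have w'P : {subset rev w <= Phi} by move=> z; rewrite mem_rev; apply: wP.
split=> [a aP|u Hu].
  by rewrite BC B_refls BC le1 // refls_root.
rewrite -(refls_Krev u wP) (span (rev w @@ u)) ?refls0 // => a aP av.
by rewrite -B_refls Hu ?refls_root // B_refls2.
Qed.
End Simple.
End Roots.

(** The dual basis is read off the inverse Gram matrix; a vector in its kernel gives a combination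
    of [b] of norm 0, hence zero coefficients. *)
Lemma dual_basis (b : seq V) : basis_of fullv b -> exists om : V -> V,
  {in b &, forall x y, B x (om y) = (x == y)%:R} /\
  (forall x, x = \sum_(y <- b) B x (om y) *: y).
Proof.
move=> bB; have bF := basis_free bB; have ub := free_uniq bF.
pose n := size b; pose X := in_tuple b.
pose G : 'M[R]_n := \matrix_(i, j) B b`_i b`_j.
have Gu : G \in unitmx.
  rewrite -row_free_unit; apply: inj_row_free => u uG.
  have x0 : \sum_(i < n) u 0 i *: b`_i = 0.
    apply: B_eq0; rewrite {2}[\sum__ _]big_mkcond /= B_sumr big1 // => j _.
    rewrite BZr B_suml; have := congr1 (fun M : 'rV__ => M 0 j) uG; rewrite !mxE => e0.
    suff -> : \sum_(i < n) B (u 0 i *: b`_i) b`_j = 0 by rewrite mulr0.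
    by rewrite -[RHS]e0; apply: eq_bigr => i _; rewrite mxE BZl.
  apply/rowP => i; rewrite mxE.
  by have /freeP/(_ (fun i => u 0 i) x0 i) := (bF : free X).
pose om y := \sum_(k < n) (if insub (index y b) is Some j then invmx G k j else 0) *: b`_k.
have omE (i j : 'I_n) : B b`_i (om b`_j) = (i == j)%:R.
  have := congr1 (fun M : 'M_n => M i j) (mulmxV Gu); rewrite !mxE => <-.
  rewrite B_sumr; apply: eq_bigr => k _; rewrite BZr mxE index_uniq ?ltn_ord //.
  by rewrite valK mulrC.
have omd : {in b &, forall x y, B x (om y) = (x == y)%:R}.
  move=> x y xb yb.
  have xi : (index x b < n)%N by rewrite index_mem.
  have yi : (index y b < n)%N by rewrite index_mem.
  have := omE (Ordinal xi) (Ordinal yi); rewrite /= !nth_index // => ->.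
  suff -> : (Ordinal xi == Ordinal yi) = (x == y) by [].
  rewrite -val_eqE /=; apply/eqP/eqP => [|->//].
  by move/(congr1 (nth 0 b)); rewrite !nth_index.
exists om; split=> // x.
have xX : x = \sum_(i < n) coord X i x *: b`_i.
  by apply: coord_span; rewrite (span_basis bB) memvf.
rewrite [RHS](big_nth 0) big_mkord {1}xX; apply: eq_bigr => i _; congr (_ *: _).
rewrite {2}xX B_suml (bigD1 i) //= BZl omE eqxx mulr1 big1 ?addr0 // => j ji.
by rewrite BZl omE (negPf ji) mulr0.
Qed.
End Form.

(** The right-hand side is the squared length of 1 + t times a root of squared length N. *)
Lemma scale_unbounded (R : realFieldType) (N M t A : R) :
  0 < N -> 0 <= A -> M <= A -> 0 <= t -> t * N = A -> M < (1 + t) * ((1 + t) * N).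
Proof.
move=> N0 A0 MA t0 tN; have tA := mulr_ge0 t0 A0.
suff -> : (1 + t) * ((1 + t) * N) = N + 2 * A + t * A by lra.
by rewrite -tN; ring.
Qed.

(** * Back to the given inner product *)

Section Normalization.
Variables (R : realType) (V : vectType R) (dot : {dot V for @idfun R}).
Variables (Phi : seq V) (N : R).
Hypothesis Phi_root : root_system dot Phi.
Hypothesis Phi_irr : irreducible dot Phi.
Hypothesis N_gt0 : 0 < N.
Hypothesis dot_N : {in Phi, forall a, dot a a = N}.
Implicit Types (a x y u v : V) (P Q : set V).

Lemma dotC x y : dot x y = dot y x.
Proof. by rewrite [LHS](@hermitian_subproof _ _ _ _ dot) expr0 mul1r. Qed.
Lemma dotDr x y z : dot x (y + z) = dot x y + dot x z.
Proof. exact: linearDr. Qed.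
Lemma dotZr k x y : dot x (k *: y) = k * dot x y.
Proof. exact: linearZr_LR. Qed.

(** With this scaling every root has norm 2, and the integers of [root_integral] are the values of
    the form itself. *)
Definition nform x y := 2 * dot x y / N.

Lemma dotE x y : dot x y = nform x y * (N / 2).
Proof. by rewrite /nform; field; rewrite gt_eqF. Qed.

Lemma nformC x y : nform x y = nform y x.
Proof. by rewrite /nform dotC. Qed.
Lemma nformDr x y z : nform x (y + z) = nform x y + nform x z.
Proof. by rewrite /nform dotDr mulrDr mulrDl. Qed.
Lemma nformZr k x y : nform x (k *: y) = k * nform x y.
Proof. by rewrite /nform dotZr; ring. Qed.
Lemma nform_gt0 x : x != 0 -> 0 < nform x x.
Proof. by move=> x0; rewrite /nform divr_gt0 // mulr_gt0 // neq0_dnorm_gt0. Qed.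

Lemma nform_root : {in Phi, forall a, nform a a = 2}.
Proof. by move=> a aP; rewrite /nform dot_N // mulfK ?gt_eqF. Qed.

Lemma reflE a x : a \in Phi -> reflection dot a x = refl nform a x.
Proof. by move=> aP; rewrite /reflection dot_N. Qed.

Lemma nrefl_root : {in Phi &, forall a x, refl nform a x \in Phi}.
Proof. by move=> a x aP xP; rewrite -reflE //; apply: root_reflection. Qed.

Lemma nform_int : {in Phi &, forall a x, nform a x \is a Num.int}.
Proof. by move=> a x aP xP; rewrite /nform -(dot_N aP); apply: (root_integral Phi_root). Qed.

Lemma reflection_prodE s : {subset s <= Phi} -> reflection_prod dot s =1 cox nform s.
Proof.
elim: s => //= a s IH sP x; rewrite /cox /= -/(cox nform s x) -IH ?reflE ?sP ?mem_head //.
by move=> y ys; apply: sP; rewrite inE ys orbT.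
Qed.

Lemma Phi_connected (p : pred V) : has p Phi -> has (predC p) Phi ->
  exists x y, [/\ x \in Phi, y \in Phi, p x, ~~ p y & nform x y <> 0].
Proof.
move=> hp hnp; apply: contrapT => H; apply: Phi_irr.2.
exists (filter p Phi), (filter (predC p) Phi); split.
- by apply/eqP; rewrite -size_eq0 size_filter -lt0n -has_count.
- by apply/eqP; rewrite -size_eq0 size_filter -lt0n -has_count.
- by move=> z; rewrite mem_cat !mem_filter /= -andb_orl orbN.
move=> x y; rewrite !mem_filter /= => /andP[px xP] /andP[py yP].
apply: contrapT => xy; apply: H; exists x, y; split=> //.
by move: xy; rewrite dotE => xy B0; apply: xy; rewrite B0 mul0r.
Qed.

Lemma dotNl x y : dot (- x) y = - dot x y.
Proof. by rewrite dotC -scaleN1r dotZr mulN1r dotC. Qed.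

Lemma opp_root a : a \in Phi -> - a \in Phi.
Proof. exact: (root_opp nform_root nrefl_root). Qed.

(** Multiplicities are written out as repetitions, so that coefficients become counts. *)
Lemma simple_sign b a : simple_roots Phi b -> a \in Phi ->
  exists2 s : seq V, {subset s <= b} & a = \sum_(y <- s) y \/ a = - \sum_(y <- s) y.
Proof.
case=> _ _ sgn /sgn[c H].
exists (flatten [seq nseq (c i) b`_i | i <- iota 0 (size b)]).
  move=> z /flattenP[t /mapP[i]]; rewrite mem_iota /= add0n => ib ->.
  by rewrite mem_nseq => /andP[_ /eqP->]; apply: mem_nth.
suff <- : \sum_(i < size b) b`_i *+ c i =
    \sum_(y <- flatten [seq nseq (c i) b`_i | i <- iota 0 (size b)]) y by [].
rewrite big_flatten big_map -(big_mkord xpredT (fun i => b`_i *+ c i)) /index_iota subn0.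
by apply: eq_bigr => i _; rewrite big_nseq iter_addr_0.
Qed.

Lemma coxeter_covering h : coxeter_number dot Phi h -> exists S : seq V,
  [/\ size S = h, uniq S,
      {in S, forall x, {in Phi, forall a, nform a x <= 1} /\
        (forall u, {in Phi, forall a, nform a x = 1 -> nform a u = 0} -> u = 0)} &
      {in Phi, forall a, exists2 x, x \in S & nform a x = 1}].
Proof.
case=> b sb bh; have [bB bP _] := sb.
have [om [omd ome]] := dual_basis nformC nformDr nformZr nform_gt0 bB.
have ub : uniq b by apply/free_uniq/(basis_free bB).
apply: (covering_seq nformC nformDr nformZr nform_gt0 nform_root nrefl_root nform_int Phi_connected ub bP omd ome).
- by move=> a; apply: simple_sign.
- apply/eqP => b0; case: Phi_irr => + _; case: Phi nform_root => // a s P2 _.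
  have := P2 a (mem_head _ _); rewrite {1}(ome a) b0 big_nil => /eqP.
  by rewrite (B0l nformC nformZr) eq_sym pnatr_eq0.
have [h0 h1 hk] := bh; have E k : iter k (reflection_prod dot b) =1 iter k (cox nform b).
  by move=> x; apply: eq_iter; apply: reflection_prodE.
split=> // [x|k kh Hk]; first by rewrite -E h1.
by apply: (hk k kh) => x; rewrite E Hk.
Qed.

Lemma symmetric_alcoved P : alcoved_polytope dot Phi P -> P !=set0 ->
  weyl_symmetric dot Phi P ->
  exists2 m : R, 0 <= m & P = [set x | forall a, a \in Phi -> dot a x <= m].
Proof.
move=> [[M PM] [Psi [c [PsiP PE]]]] [x0 Px0] sym.
have [a0 a0P] : exists a, a \in Phi.
  by case: Phi_irr => + _; case: Phi => // a s _; exists a; rewrite mem_head.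
(* Without inequalities P would be all of V, and a large multiple of a root would violate the
   bound. *)
have [a1 a1Psi] : exists a, a \in Psi.
  case: Psi PE {PsiP} => [PE|a s _]; last by exists a; rewrite mem_head.
  have := PM ((1 + `|M| / N) *: a0); rewrite PE => /(_ _); rewrite dotZr dotC dotZr dot_N // => H.
  have {}H := H (fun a => fun ain => match notF ain with end).
  have k0 : 0 <= `|M| / N by rewrite divr_ge0 // ltW.
  have kN : `|M| / N * N = `|M| by rewrite divfK // gt_eqF.
  by move: H; rewrite leNgt (scale_unbounded N_gt0 _ (ler_norm M) k0 kN).
(* The smallest bound of Psi: by symmetry of P and transitivity on roots it holds for every root,
   and it implies the other bounds. *)
have [a aPsi amin] := seq_max (fun a => - c a) a1Psi.
have aP := PsiP a aPsi.
have PE' : P = [set x | forall a', a' \in Phi -> dot a' x <= c a].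
  rewrite predeqE => x; split=> [Px a' a'P|H].
    have [s sP sa] := root_transitive nformC nformDr nformZr nform_gt0 nform_root nrefl_root nform_int Phi_connected a'P aP.
    have Pw : P (reflection_prod dot s x).
      rewrite -(sym (reflection_prod dot s)); last by exists s.
      by exists x.
    move: Pw; rewrite PE => /(_ a aPsi).
    by rewrite !dotE reflection_prodE // /cox -sa (B_refls2 nformC nformDr nformZr nform_root).
  rewrite PE => a' a'Psi; apply: le_trans (H a' (PsiP a' a'Psi)) _.
  by have := amin a' a'Psi; rewrite lerN2.
exists (c a) => //.
move: Px0; rewrite PE' => H; have := H a aP.
by have := H _ (opp_root aP); rewrite dotNl; lra.
Qed.
End Normalization.

(** * The generating vertices of the polytope *)

Theorem theorem4p4 (R : realType) (V : vectType R) (dot : {dot V for @idfun R})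
    (Phi : seq V) (h : nat) (P : set V)
    (Phi_root : root_system dot Phi) (Phi_red : reduced Phi)
    (Phi_irr : irreducible dot Phi) (Phi_sl : simply_laced dot Phi)
    (Phi_h : coxeter_number dot Phi h)
    (P_alc : alcoved_polytope dot Phi P) (P_n0 : P !=set0)
    (P_sym : weyl_symmetric dot Phi P) :
  exists S : seq V,
    [/\ size S = h,
        (P <> [set 0] -> uniq S),
        (forall v, v \in S -> vertex dot P v)
      & generating_set dot Phi P [set` S]].
Proof.
have [a0 a0P] : exists a, a \in Phi.
  by case: Phi_irr => + _; case: (Phi) => // a s _; exists a; rewrite mem_head.
pose N := dot a0 a0.
have N_gt0 : 0 < N.
  by apply: neq0_dnorm_gt0; apply: contraNneq (root_neq0 Phi_root) => <-.
have dot_N : {in Phi, forall a, dot a a = N} by move=> a aP; apply: Phi_sl.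
have [m m_ge0 PE] := symmetric_alcoved Phi_root Phi_irr N_gt0 dot_N P_alc P_n0 P_sym.
have [S [Sh uS SP cov]] := coxeter_covering Phi_root Phi_irr N_gt0 dot_N Phi_h.
have dotE' x y : dot x y = nform dot N x y * (N / 2) by apply: dotE.
have N2 : 0 < N / 2 by rewrite divr_gt0.
have [m_gt0|m_le0] := ltP 0 m; last first.
  have {m_ge0 m_le0} m0 : m = 0 by apply/le_anti; rewrite m_le0.
  have P0 x : P x -> x = 0.
    (* Both a and -a are at most 0 on x, so x is orthogonal to all roots, in particular to the
       spanning set of roots tight at v. *)
    rewrite PE m0 => Px; have [v vS _] := cov _ a0P.
    have [_ span] := SP v vS; apply: span => a aP _.
    have l1 := Px a aP; have := Px _ (opp_root Phi_root N_gt0 dot_N aP); rewrite dotNl => l2.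
    have : nform dot N a x * (N / 2) = 0.
      by rewrite -dotE'; apply/le_anti; rewrite l1 -oppr_le0 l2.
    by move/eqP; rewrite mulf_eq0 (gt_eqF N2) orbF => /eqP.
  have Pz : P 0 by have [x Px] := P_n0; rewrite -(P0 x Px).
  have h_gt0 : (0 < h)%N by case: Phi_h => b _ [].
  (* The polytope {0} has a single vertex, listed h times. *)
  exists (nseq h 0); split.
  - by rewrite size_nseq.
  - by case; rewrite predeqE => x; split=> [/P0|->].
  - move=> v; rewrite mem_nseq => /andP[_ /eqP->]; split=> //.
    by exists 0 => x /P0.
  split=> // [x /=|Q _ SQ x /P0->].
    by rewrite mem_nseq => /andP[_ /eqP->].
  by apply: SQ; rewrite /= mem_nseq h_gt0 eqxx.
(* Scaling by k carries level 1 of [nform] to level m of [dot]. *)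
pose k := m / (N / 2).
have k_gt0 : 0 < k by rewrite divr_gt0.
have dotk a x : dot a (k *: x) = m * nform dot N a x.
  by rewrite dotZr dotE' /k mulrCA mulrC divfK ?gt_eqF // mulrC.
have kP v : v \in S -> P (k *: v).
  move=> /SP[le1 _]; rewrite PE => a aP.
  by rewrite dotk ler_piMr // le1.
exists [seq k *: x | x <- S]; split.
- by rewrite size_map.
- by move=> _; rewrite map_inj_uniq //; apply: scalerI; rewrite gt_eqF.
- move=> _ /mapP[v vS ->]; split; first exact: kP.
  (* The sum of the tight roots exposes k v: each of them is maximal there, and equality in all
     forces x = k v because they span V. *)
  pose F := [seq a <- Phi | nform dot N a v == 1].
  exists (\sum_(a <- F) a) => x Px xv.
  have sumE y : dot (\sum_(a <- F) a) y = \sum_(a <- F) dot a y.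
    rewrite dotC; elim: F => [|a s IH]; first by rewrite !big_nil -(scale0r 0) dotZr mul0r.
    by rewrite !big_cons dotDr IH dotC.
  have Fle a : a \in F -> dot a x <= dot a (k *: v).
    rewrite mem_filter => /andP[/eqP av aP]; rewrite dotk av mulr1.
    by move: Px; rewrite PE; apply.
  rewrite !sumE lt_neqAle; apply/andP; split; last by rewrite !big_seq ler_sum.
  apply: contra_notN xv; rewrite eq_sym -subr_eq0 -sumrB big_seq psumr_eq0 => [|a aF]; last first.
    by rewrite subr_ge0 Fle.
  move=> /allP H; have [_ span] := SP v vS.
  apply/eqP; rewrite -subr_eq0; apply/eqP; apply: span => a aP av.
  have aF : a \in F by rewrite mem_filter av eqxx.
  have := H a aF; rewrite aF /= subr_eq0 => /eqP e.
  have : nform dot N a (x - k *: v) * (N / 2) = 0.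
    by rewrite -dotE' dotDr -scaleN1r dotZr e mulN1r subrr.
  by move/eqP; rewrite mulf_eq0 (gt_eqF N2) orbF => /eqP.
split=> // [_ /= /mapP[v vS ->]|Q [_ [Psi [c [PsiP ->]]]] SQ x Px a aPsi]; first exact: kP.
(* Some generator has value m on a, so the bound c a of Q is at least m. *)
have aP := PsiP a aPsi; have [v vS av] := cov a aP.
have := SQ (k *: v); rewrite /= map_f // => /(_ isT a aPsi).
by rewrite dotk av mulr1; apply: le_trans; move: Px; rewrite PE; apply.
Qed.
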